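(* There are universal constants $c,C>0$ such that for every $p\in(1,2]$ and every $n\in\mathbb N$, $$c(\log n)^{\frac1p}\le\mathsf{SEP}^n(\ell_p)\le C\,\frac{(\log n)^{\frac1p}}{p-1}.$$
   Context: $\ell_p$ is the usual space of real $p$-summable sequences with the metric induced by its norm. A random partition $\mathscr P$ of a metric space $(\mathcal M,d_{\mathcal M})$ consists of a probability space $(\Omega,\mathbf{Prob})$ and set-valued mappings $\Gamma^k:\Omega\to2^{\mathcal M}$, $k\in\mathbb N$, such that $\mathscr P^\omega=\{\Gamma^k(\omega)\}_{k=1}^\infty$ is a partition of $\mathcal M$ for every $\omega\in\Omega$ (empty clusters are allowed) and each $\Gamma^k$ is strongly measurable, i.e., $\{\omega:\ E\cap\Gamma^k(\omega)\neq\emptyset\}$ is $\mathbf{Prob}$-measurable for every closed $E\subseteq\mathcal M$. $\mathscr P(x)$ denotes the cluster containing $x$. $\mathscr P$ is $\Delta$-bounded if every cluster of $\mathscr P^\omega$ has $d_{\mathcal M}$-diameter at most $\Delta$, for every $\omega$. A $\Delta$-bounded $\mathscr P$ is $\sigma$-separating if $\mathbf{Prob}[\mathscr P(x)\ne\mathscr P(y)]\le\frac{\sigma}{\Delta}d_{\mathcal M}(x,y)$ for all $x,y\in\mathcal M$. $\mathsf{SEP}(\mathcal M)$ is the infimum over those $\sigma>0$ such that for every $\Delta>0$ there is a $\sigma$-separating $\Delta$-bounded random partition of $\mathcal M$ ($\infty$ if there is no such $\sigma$). The size-$n$ separation modulus is $\mathsf{SEP}^n(\mathcal M)=\sup\{\mathsf{SEP}(S,d_{\mathcal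 M}):\ S\subseteq\mathcal M,\ |S|\le n\}$. *)

(* Defs.v *)
From HB Require Import structures.
From mathcomp Require Import all_boot all_order all_algebra.
From mathcomp Require Import all_classical all_reals all_analysis.

Set Implicit Arguments.
Unset Strict Implicit.
Unset Printing Implicit Defensive.

Import Order.TTheory GRing.Theory Num.Theory.
Import numFieldNormedType.Exports.

Local Open Scope classical_set_scope.
Local Open Scope ring_scope.

(* The induced metric on a subset; its balls, hence its topology, are those
   already carried by [set_type A]. *)
Section subset_metric.
Context {R : realType} {M : metricType R} (A : set M).

Let sdist (x y : A) : R := mdist (set_val x) (set_val y).

Let sdist_ge0 x y : 0 <= sdist x y.
Proof. exact: mdist_ge0. Qed.

Let sdist_positivity x y : sdist x y = 0 -> x = y.
Proof. by move=> /mdist_positivity xy; apply: val_inj; rewrite -!set_valE. Qed.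

Let ballEsdist x e : ball x e = [set y | sdist x y < e].
Proof. by rewrite -initial_ballE ballEmdist. Qed.

HB.instance Definition _ := @PseudoMetric_isMetric.Build R (set_type A)
  sdist sdist_ge0 sdist_positivity ballEsdist.

End subset_metric.

(* Real sequences with finite p-norm. Every sequence is measurable since [nat]
   is discrete, and equality is equality of sequences (no a.e. quotient). *)
Definition ell (R : realType) (p : R) (p1 : 1 <= p) : Type :=
  LfunType (@counting nat R) (p1 : (1 <= p%:E)%E).

Section ell_metric.
Context (R : realType) (p : R) (p1 : 1 <= p).

HB.instance Definition _ := Choice.on (ell p1).

Local Notation T := (LfunType (@counting nat R) (p1 : (1 <= p%:E)%E)).

Let edist (u v : ell p1) : R :=
  fine ('N[counting]_(p%:E) [EFin \o ((u : T) - (v : T))%R])%E.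

Let edistxx u : edist u u = 0.
Proof.
rewrite /edist subrr [X in ('N[_]__[X])%E](_ : _ = cst 0%E) ?Lnorm0//.
by rewrite eqe gt_eqF// (lt_le_trans ltr01).
Qed.

Let edist_positivity u v : edist u v = 0 -> u = v.
Proof.
move=> uv; apply/eqP; rewrite -subr_eq0; apply/eqP/LfuneqP => n.
have [/= N [mN N0 sN]] := fine_Lnormr_eq0 uv.
apply: contrapT => un.
have Nn : N n by apply: sN => /= /(_ I).
have : (counting [set n] <= counting N :> \bar R)%E.
  by apply: le_measure; rewrite ?inE// => k ->.
by rewrite N0 /counting asboolT// fset_set1 finmap.cardfs1 lee_fin ler10.
Qed.

Let edist_sym u v : edist u v = edist v u.
Proof.
rewrite /edist -(LnormrN ((u : T) - (v : T))); congr (fine (Lnorm _ _ _)).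
by apply/funext => n /=; rewrite opprB.
Qed.

Let edist_triangle v u w : edist u w <= edist u v + edist v w.
Proof.
apply: le_trans (ler_LnormD _ _); rewrite le_eqVlt; apply/orP; left; apply/eqP.
congr (fine (Lnorm _ _ _)).
by apply/funext => n /=; congr EFin; rewrite addrA subrK.
Qed.

HB.instance Definition _ := @isMetric.Build R (ell p1)
  edist edistxx edist_positivity edist_sym edist_triangle.

Lemma ell_mdistE (u v : ell p1) : mdist u v =
  fine ('N[counting]_(p%:E) [(fun n => ((u : T) n - (v : T) n)%R%:E)])%E.
Proof. by []. Qed.

End ell_metric.

Section separation.
Context {R : realType} {M : metricType R}.

Section random_partition.
Context d (Omega : measurableType d) (Gamma : nat -> Omega -> set M).

(* [trivIset] allows empty clusters. *)
Definition random_partition : Prop :=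
  [/\ forall w, trivIset setT (Gamma ^~ w),
      forall w, \bigcup_k Gamma k w = setT &
      forall k (E : set M), closed E ->
        measurable [set w | E `&` Gamma k w !=set0]].

Definition cluster_of (w : Omega) (x : M) : set M :=
  \bigcup_(k in [set k | Gamma k w x]) Gamma k w.

Definition bounded_partition (Delta : R) : Prop :=
  forall w k x y, Gamma k w x -> Gamma k w y -> mdist x y <= Delta.

(* For a random partition this event is measurable, points being closed. *)
Definition separating_partition (P : probability Omega R) (sigma Delta : R)
    : Prop :=
  forall x y, (P [set w | cluster_of w x <> cluster_of w y] <=
    (sigma / Delta * mdist x y)%:E)%E.

End random_partition.

Definition separable_with (sigma : R) : Prop :=
  forall Delta : R, 0 < Delta ->
    exists (d : measure_display) (Omega : measurableType d)
      (P : probability Omega R) (Gamma : nat -> Omega -> set M),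
      [/\ random_partition Gamma, bounded_partition Gamma Delta &
          separating_partition Gamma P sigma Delta].

End separation.
Arguments separable_with {R} M sigma.

(* The infimum of the empty set is +oo. *)
Definition SEP (R : realType) (M : metricType R) : \bar R :=
  ereal_inf [set sigma%:E | sigma in
    [set sigma : R | 0 < sigma /\ separable_with M sigma]].

Definition SEPn (R : realType) (n : nat) (M : metricType R) : \bar R :=
  ereal_sup [set SEP (set_type S) | S in [set S : set M | (S #<= `I_n)%card]].

(* Main.v *)
From HB Require Import structures.
Require Import Defs.
From mathcomp Require Import all_boot all_order all_algebra.
From mathcomp Require Import all_classical all_reals all_analysis.
From mathcomp Require Import measurable_realfun.
From mathcomp Require Import zify ring lra complex.

Set Implicit Arguments.
Unset Strict Implicit.
Unset Printing Implicit Defensive.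

Import Order.TTheory GRing.Theory Num.Theory.
Import numFieldNormedType.Exports.

Local Open Scope ring_scope.

(** Both bounds reduce to finite combinatorics.

    Lower bound. Take [n >= 2 ^ d] and embed the discrete cube [{0, 1} ^ d] in
    l_p, so that Hamming distance becomes the p-th power of the norm distance.
    A subset of the cube of Hamming diameter at most [d / 4] has few internal
    edges: relative to a base point of the subset, each point has at most
    [d / 4] internal edges going towards the base point, and each internal edge
    goes towards it from one of its two ends. Hence every partition into such
    clusters cuts at least half of the edges ([cut_edges]). Edges have length 1
    while the diameter allowed is [(d / 4) ^ (1 / p)], so averaging over the
    random partition forces [sigma] to be at least half of this number
    ([cube_separation], [SEPn_ge]).

    Upper bound. Let S be a set of n points of l_p and D the desired diameter.

    - It suffices to find finitely many nonnegative functions psi_z on S, each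
      supported on a set of diameter at most D, with [\sum_z psi_z x >= 1 / 2]
      and [\sum_z |psi_z x - psi_z y|] controlled by the distance of x and y:
      carving S successively by random level sets of the psi_z gives a partition
      which separates x from y with probability at most twice that sum
      ([carving_partition]).

    - Let h be a random function from S to [-1, 1] whose second moment is 1 / 2
      at every point, while the mean of [h x * h y] is smaller by a constant for
      points at distance more than D / 2. Take [m ~ log n] independent copies
      of h and, given those, signs z_i which are biased towards h_i(x), giving
      a law mu_x. The statistic [\sum_i z_i * h_i y] is then larger under mu_x
      for y = x than for y far from x, with failure probability polynomially
      small in n. Multiplying the density of mu_x by a ramp of the statistic at
      x and discarding the few outcomes for which two far points both pass gives
      the functions psi. As the squared Hellinger distance is subadditive over
      independent coordinates, the l_1 distance of psi at x and y is at most a constant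
      times the mean of the Euclidean norm of [(h_i x - h_i y)_i]
      ([correlated_functionals_partition]).

    - Such an h is the cosine of a random linear functional of p-stable type
      with a random phase: the functional is a sum of independent signed terms
      [2 ^ l * x_k] which occur with probability of order [2 ^ (- l * p)]. The
      mean of the cosine factors over the terms, and dyadic sums show that it is
      bounded away from 1 for far points ([walk_cos_mean_le], [energy_ge]).
      Truncating the terms at the level [T = m ^ (1 / p) * |x - y|] bounds the
      mean Euclidean norm of m copies by a constant times [T / (p - 1)]: the
      small terms have second moment of order [T ^ 2 / m], and the large ones
      mean of order [T / (m * (p - 1))], which is where [p - 1] enters
      ([wave_displacement_mean], [energy_le], [overflow_le]).

    Since [m ~ log n], this is the bound [(log n) ^ (1 / p) / (p - 1)]. *)

(** * Random partitions from weighted families of sets *)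

Section carving.
Variables (R : realType) (I : finType).
Implicit Types (A : {set I}) (V : {set {set I}}) (x y : I).

Definition separates A x y := (x \in A) != (y \in A).

Definition meets A x y := (x \in A) || (y \in A).

Definition carve A (g : {ffun I -> {set I}}) : {ffun I -> {set I}} :=
  [ffun x => if x \in A then A else g x].

(** The outcome of carving: the label of a point is the first set of the family
    [V] that contains it, where sets are drawn without replacement with
    probabilities proportional to [w]. In the last clause the ratio of the two
    sums over sets is the chance that the first set meeting [{x, y}] separates
    the two points. *)
Definition carving_law (w : {set I} -> R) V (P : {ffun I -> {set I}} -> R) :=
  [/\ forall g, 0 <= P g,
    \sum_g P g = 1,
    forall g, 0 < P g -> forall x A, A \in V -> x \in A ->
      (x \in g x) && (g x \in V) &
    forall x y, (\sum_(g : {ffun I -> {set I}} | g x != g y) P g) *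
      (\sum_(A in V | meets A x y) w A) <= \sum_(A in V | separates A x y) w A].

(** Induction on the size of the family. Draw the first set [A] and carve the
    rest by the law for [V :\ A]. If [A] meets [{x, y}] the pair is decided now;
    otherwise both weights in the bound for [V :\ A] are those for [V], so the
    bound reproduces itself. *)
Lemma exists_carving_law (w : {set I} -> R) V :
  (forall A, A \in V -> 0 < w A) -> exists P, carving_law w V P.
Proof.
have [k] := ubnP #|V|; elim: k V => // k IH V cV w0.
have [V0|[A0 A0V]] := set_0Vmem V.
  exists (fun g => (g == [ffun => finset.set0])%:R); split=> [g||g _ x A|x y].
  - by rewrite ler0n.
  - rewrite (bigD1 [ffun => finset.set0])//= eqxx big1 ?addr0// => g.
    by move/negPf->.
  - by rewrite V0 finset.inE.
  - have E (D : pred {set I}) : \sum_(A in V | D A) w A = 0.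
      by apply: big_pred0 => A; rewrite V0 finset.inE.
    by rewrite !E mulr0.
have [Q QP] : exists Q, forall A, A \in V -> carving_law w (V :\ A) (Q A).
  have H A : exists P, A \in V -> carving_law w (V :\ A) P.
    case: (boolP (A \in V)) => [AV|_]; last by exists (fun=> 0).
    have [||P HP] := IH (V :\ A); last by exists P.
    - by move: cV; rewrite (cardsD1 A) AV.
    - by move=> B /setD1P[_ /w0].
  by have [Q HQ] := boolp.choice H; exists Q.
pose W := \sum_(A in V) w A.
have W0 : 0 < W.
  by rewrite /W (bigD1 A0)//= ltr_wpDr ?w0// sumr_ge0// => B /andP[/w0/ltW].
pose P g := \sum_(A in V) w A / W * \sum_(g' | carve A g' == g) Q A g'.
have Psum (D : pred {ffun I -> {set I}}) : \sum_(g | D g) P g =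
    \sum_(A in V) w A / W * \sum_(g' | D (carve A g')) Q A g'.
  rewrite /P exchange_big; apply: eq_bigr => A AV /=.
  rewrite -mulr_sumr; congr (_ * _).
  rewrite (exchange_big_dep (fun g' => D (carve A g')))/=; last first.
    by move=> g g' Dg /eqP->.
  apply: eq_bigr => g' Dg'; rewrite (big_pred1 (carve A g'))// => g /=.
  by rewrite [g == _]eq_sym; case: eqP => [<-|]; rewrite ?Dg'// andbF.
have wW A : A \in V -> 0 <= w A / W.
  by move=> /w0 wA; rewrite divr_ge0// ltW.
exists P; split.
- move=> g; apply: sumr_ge0 => A AV; rewrite mulr_ge0 ?wW// sumr_ge0// => g' _.
  by have [] := QP _ AV.
- rewrite (Psum predT) (eq_bigr (fun A => w A / W)).
    by rewrite -mulr_suml divff// gt_eqF.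
  by move=> A AV; have [_ -> _ _] := QP _ AV; rewrite mulr1.
- move=> g Pg x B BV xB.
  have [A AV] : exists2 A, A \in V &
      exists2 g', carve A g' == g & 0 < Q A g'.
    apply: contrapT => noA; move: Pg; rewrite /P big1 ?ltxx// => A AV.
    rewrite big1 ?mulr0// => g' g'g; apply/eqP.
    rewrite eq_le (_ : 0 <= _) ?andbT; last by have [] := QP _ AV.
    by rewrite leNgt; apply/negP => Q0; apply: noA; exists A => //; exists g'.
  case=> g' /eqP <- Q0; rewrite ffunE; case: ifPn => xA; first by rewrite xA AV.
  have [_ _ Qc _] := QP _ AV.
  have BVA : B \in V :\ A.
    by rewrite !finset.inE BV andbT; apply: contraNneq xA => <-.
  by have /andP[-> /setD1P[]] := Qc _ Q0 x B BVA xB.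
- move=> x y.
  set S := \sum_(A in V | separates A x y) w A.
  set H := \sum_(A in V | meets A x y) w A.
  have WE : W = H + \sum_(A in V | ~~ meets A x y) w A.
    by rewrite /W (bigID (fun A => meets A x y)).
  have SE : S = \sum_(A in V | meets A x y) (separates A x y)%:R * w A.
    rewrite /S big_mkcondr [RHS]big_mkcondr; apply: eq_bigr => A _.
    by rewrite /separates /meets;
      case: (x \in A); case: (y \in A); rewrite ?mul1r ?mul0r.
  rewrite Psum mulr_suml.
  apply: (@le_trans _ _ (\sum_(A in V) (w A / W *
    (if meets A x y then (separates A x y)%:R * H else S)))).
    apply: ler_sum => A AV; rewrite -mulrA ler_wpM2l ?wW//.
    have [Q0 Q1 _ Qs] := QP _ AV.
    have H0 : 0 <= H by apply: sumr_ge0 => B /andP[/w0/ltW].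
    case: ifPn => [mA|].
      rewrite ler_wpM2r// /separates; move: mA; rewrite /meets.
      case xA: (x \in A); case yA: (y \in A) => //= _.
      + by rewrite big1// => g; rewrite !ffunE xA yA eqxx.
      + rewrite -Q1 [leRHS](bigID (fun g => carve A g x != carve A g y))/=.
        by rewrite lerDl sumr_ge0.
      + rewrite -Q1 [leRHS](bigID (fun g => carve A g x != carve A g y))/=.
        by rewrite lerDl sumr_ge0.
    move=> mA; have eqV (D : pred {set I}) : (forall B, D B -> meets B x y) ->
        (fun B => (B \in V :\ A) && D B) =1 (fun B => (B \in V) && D B).
      move=> Dm B; rewrite !finset.inE -andbA; case: (eqVneq B A) => //= ->.
      by rewrite AV/=; apply/esym/negP => /Dm; apply/negP.
    move: mA; rewrite negb_or => /andP[xA yA].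
    have := Qs x y; rewrite !(eq_bigl _ _ (eqV _ _))//; last first.
      by move=> B; rewrite /separates /meets; case: (x \in B); case: (y \in B).
    congr (_ * _ <= _).
    by apply: eq_bigl => g; rewrite !ffunE (negPf xA) (negPf yA).
  rewrite (bigID (fun A => meets A x y))/=.
  rewrite (eq_bigr (fun A => (separates A x y)%:R * w A * (H / W))); last first.
    by move=> A /andP[_ ->]; ring.
  rewrite -mulr_suml -SE [X in _ + X](eq_bigr (fun A => w A * (S / W))); last first.
    by move=> A /andP[_ /negPf->]; ring.
  rewrite -mulr_suml (_ : _ + _ =
    S * (H + \sum_(A in V | ~~ meets A x y) w A) / W); last by ring.
  by rewrite -WE -mulrA divff ?mulr1// gt_eqF.
Qed.

(** Peel off the minimum of [psi] over its support, which shrinks the support.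
    The level sets obtained are nested, so the weights of the sets separating
    two points add up to the difference of the two values. *)
Lemma layer_cake (psi : I -> R) : (forall x, 0 <= psi x) ->
  exists c : {set I} -> R, [/\ forall A, 0 <= c A,
    forall A, 0 < c A -> forall x, x \in A -> 0 < psi x,
    forall x, \sum_(A : {set I} | x \in A) c A = psi x &
    forall x y, \sum_(A | separates A x y) c A <= `|psi x - psi y|].
Proof.
have [k] := ubnP #|[pred x | 0 < psi x]|; elim: k psi => // k IH psi cpsi psi0.
case: (pickP [pred x | 0 < psi x]) => [x0 /= x0p|psiz]; last first.
  have {}psiz x : psi x = 0.
    apply/eqP; rewrite eq_le psi0 andbT leNgt.
    by have /= -> := psiz x.
  exists (fun=> 0); split=> //.
  - by move=> A; rewrite ltxx.
  - by move=> x; rewrite big1// psiz.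
  - by move=> x y; rewrite big1.
pose B := [set x | 0 < psi x]%SET.
pose xm := [arg min_(x < x0 in B) psi x]%O.
have [xmB xmle] : 0 < psi xm /\ forall x, 0 < psi x -> psi xm <= psi x.
  rewrite /xm; case: Order.TotalTheory.arg_minP => [|x]; first by rewrite finset.inE.
  by rewrite finset.inE => xp H; split=> // y yp; apply: H; rewrite finset.inE.
pose psi' x := psi x - psi xm * (x \in B)%:R.
have psi'0 x : 0 <= psi' x.
  rewrite /psi' finset.inE; case: ltP => [/xmle|_]; rewrite ?mulr1 ?subr_ge0//.
  by rewrite mulr0.
have psi'p x : 0 < psi' x -> 0 < psi x.
  by move=> /lt_le_trans; apply; rewrite gerBl mulr_ge0// ltW.
have [|c [c0 cB cs cd]] := IH _ _ psi'0.
  rewrite -ltnS; apply: leq_trans cpsi; rewrite ltnS; apply: proper_card.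
  apply/properP; split; first by apply/fintype.subsetP => x; rewrite !finset.inE; exact: psi'p.
  exists xm; first by rewrite finset.inE.
  by rewrite finset.inE /psi' finset.inE xmB mulr1 subrr ltxx.
exists (fun A => c A + psi xm * (A == B)%:R); split.
- by move=> A; rewrite addr_ge0// mulr_ge0// ltW.
- move=> A; case: (eqVneq A B) => [-> _ x|_]; first by rewrite finset.inE.
  by rewrite mulr0 addr0 => /cB H x /H /psi'p.
- move=> x; rewrite big_split/= cs /psi' -mulr_sumr -natr_sum.
  rewrite -[RHS](subrK (psi xm * (x \in B)%:R)); congr (_ + _ * _%:R).
  rewrite -big_mkcondr/=; case: (boolP (x \in B)) => xB.
    by rewrite (big_pred1 B)// => A /=; case: eqP => [->|]; rewrite ?xB ?andbF.
  by rewrite big_pred0// => A; case: eqP => [->|]; rewrite ?(negPf xB) ?andbF.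
- move=> x y; rewrite big_split/= -mulr_sumr.
  have -> : \sum_(A | separates A x y) (A == B)%:R =
      (separates B x y)%:R :> R.
    rewrite -natr_sum -big_mkcondr/=; congr _%:R.
    case: (boolP (separates B x y)) => xB.
      by rewrite (big_pred1 B)// => A /=; case: eqP => [->|]; rewrite ?xB ?andbF.
    by rewrite big_pred0// => A; case: eqP => [->|]; rewrite ?(negPf xB) ?andbF.
  apply: le_trans (lerD (cd x y) (lexx _)) _.
  rewrite /separates /psi' !finset.inE.
  have := psi'0 x; have := psi'0 y; rewrite /psi' !finset.inE.
  have := psi0 x; have := psi0 y.
  case: (ltP 0 (psi x)) => px; case: (ltP 0 (psi y)) => py /=; rewrite ?mulr1 ?mulr0 ?subr0 ?addr0.
  + by move=> _ _ _ _; rewrite opprB subrKA.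
  + move=> y0 _ _ x0'; have -> : psi y = 0 by apply/eqP; rewrite eq_le py.
    by rewrite !subr0 ger0_norm// ger0_norm ?subrK// ltW.
  + move=> y0 x0' y1 _; have -> : psi x = 0 by apply/eqP; rewrite eq_le px.
    by rewrite !sub0r !normrN ger0_norm// ger0_norm ?subrK.
  + by [].
Qed.

(** Every bounded-support partition of unity [psi], normalised only up to a
    factor 2, yields a random partition which is as Lipschitz as [psi] is in
    l_1. The weight of a set is its total weight in the layer-cake
    decompositions of the functions [psi z]. *)
Lemma carving_partition (Z : finType) (psi : Z -> I -> R) (near : rel I) :
  (forall z x, 0 <= psi z x) ->
  (forall z x y, 0 < psi z x -> 0 < psi z y -> near x y) ->
  (forall x, 2^-1 <= \sum_z psi z x) ->
  exists P : {ffun I -> {set I}} -> R, [/\ forall g, 0 <= P g,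
    \sum_g P g = 1,
    forall g, 0 < P g -> forall x y, g x = g y -> near x y &
    forall x y, \sum_(g : {ffun I -> {set I}} | g x != g y) P g <=
      2 * \sum_z `|psi z x - psi z y|].
Proof.
move=> psi0 psin psi1.
have [c cP] := boolp.choice (fun z => layer_cake (psi0 z)).
pose w A := \sum_z c z A; pose V := [set A | 0 < w A]%SET.
have w0 A : 0 <= w A by apply: sumr_ge0 => z _; have [] := cP z.
have wV (D : pred {set I}) : \sum_(A in V | D A) w A = \sum_(A | D A) w A.
  rewrite big_mkcondl; apply: eq_bigr => A _; rewrite finset.inE; case: ltP => //.
  by move=> wA; apply/eqP; rewrite eq_le w0.
have [A|P [P0 P1 PV Psep]] := @exists_carving_law w V; first by rewrite finset.inE.
have meetge x y : 2^-1 <= \sum_(A | meets A x y) w A.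
  apply: le_trans (psi1 x) _.
  rewrite (eq_bigr (fun z => \sum_(A : {set I} | x \in A) c z A)); last first.
    by move=> z _; have [_ _ ->] := cP z.
  rewrite exchange_big/= [leRHS](bigID (fun A : {set I} => x \in A))/=.
  rewrite [X in X + _](eq_bigl (fun A : {set I} => x \in A)); last first.
    by move=> A; rewrite /meets; case: (x \in A); rewrite ?andbF.
  by rewrite lerDl sumr_ge0.
have cover x : exists2 A, A \in V & x \in A.
  apply: contrapT => noA; have := psi1 x; rewrite leNgt => /negP; apply.
  rewrite big1 ?invr_gt0// => z _; have [_ _ <- _] := cP z.
  rewrite big1// => A xA; apply/eqP; apply: contrapT => cA; apply: noA.
  exists A => //; rewrite finset.inE /w (bigD1 z)//= ltr_wpDr//.
    by apply: sumr_ge0 => z' _; have [] := cP z'.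
  by rewrite lt_neqAle eq_sym; have [-> _ _ _] := cP z; rewrite andbT; apply/negP.
exists P; split => //.
- move=> g gP x y gxy.
  have [A AV xA] := cover x; have [B BV yB] := cover y.
  have /andP[xg gV] := PV _ gP _ _ AV xA.
  have /andP[yg _] := PV _ gP _ _ BV yB.
  move: gV; rewrite finset.inE /w => wg.
  have [z cz] : exists z, 0 < c z (g x).
    apply: contrapT => noz; move: wg; rewrite big1 ?ltxx// => z _; apply/eqP.
    rewrite eq_le; have [-> _ _ _] := cP z; rewrite andbT leNgt.
    by apply/negP => cz; apply: noz; exists z.
  have [_ cn _ _] := cP z.
  by apply: (psin z); apply: cn cz _ _; rewrite // gxy.
- move=> x y; have := Psep x y; rewrite !wV => Psep'.
  apply: (@le_trans _ _ (2 * \sum_(A | separates A x y) w A)); last first.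
    rewrite ler_wpM2l// /w exchange_big/=; apply: ler_sum => z _.
    by have [] := cP z.
  rewrite -ler_pdivrMl// mulrC; apply: le_trans Psep'.
  by rewrite ler_wpM2l// sumr_ge0.
Qed.

End carving.

(** * Finite sums, Chernoff bounds and tilted signs *)

Section finite_sums.
Variable R : realType.

Lemma cauchy_schwarz_sum (T : finType) (f g : T -> R) :
  (\sum_t f t * g t) ^+ 2 <= (\sum_t f t ^+ 2) * (\sum_t g t ^+ 2).
Proof.
set A := \sum_t f t ^+ 2; set B := \sum_t _ * _; set C := \sum_t g t ^+ 2.
have C0 : 0 <= C by apply: sumr_ge0 => t _; exact: sqr_ge0.
have : 0 <= \sum_t (C * f t - B * g t) ^+ 2.
  by apply: sumr_ge0 => t _; exact: sqr_ge0.
have -> : \sum_t (C * f t - B * g t) ^+ 2 = C * (A * C - B ^+ 2).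
  rewrite (eq_bigr (fun t => C ^+ 2 * f t ^+ 2 - 2 * C * B * (f t * g t) +
    B ^+ 2 * g t ^+ 2)); last by move=> t _; ring.
  by rewrite big_split/= sumrB -!mulr_sumr -/A -/B -/C; ring.
case: (ltP 0 C) => [Cp|Cn]; first by rewrite pmulr_rge0// subr_ge0.
have {Cn} CE : C = 0 by apply/eqP; rewrite eq_le Cn.
have g0 t : g t = 0.
  apply/eqP; rewrite -sqrf_eq0; apply/eqP.
  by apply: (psumr_eq0P _ CE) => // i _; exact: sqr_ge0.
by move=> _; rewrite CE mulr0 /B big1 ?expr0n// => t _; rewrite g0 mulr0.
Qed.

Lemma sum_abs_mul_le (T : finType) (f g : T -> R) :
  \sum_t `|f t * g t| <=
  Num.sqrt (\sum_t f t ^+ 2) * Num.sqrt (\sum_t g t ^+ 2).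
Proof.
have f0 (k : T -> R) : 0 <= \sum_t k t ^+ 2.
  by apply: sumr_ge0 => t _; exact: sqr_ge0.
rewrite -(@ler_pXn2r _ 2)// ?nnegrE ?mulr_ge0 ?sqrtr_ge0 ?sumr_ge0//.
rewrite exprMn !sqr_sqrtr//.
rewrite (eq_bigr (fun t => `|f t| * `|g t|)); last first.
  by move=> t _; rewrite normrM.
apply: le_trans (cauchy_schwarz_sum _ _) _; rewrite le_eqVlt; apply/orP; left.
by apply/eqP; congr (_ * _); apply: eq_bigr => t _; rewrite real_normK ?num_real.
Qed.

Lemma sum_ffun_prod (T : finType) (m : nat) (F : T -> R) :
  \sum_(f : {ffun 'I_m -> T}) \prod_i F (f i) = (\sum_t F t) ^+ m.
Proof.
by rewrite -(bigA_distr_bigA (fun=> F)) prodr_const card_ord.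
Qed.

Lemma sum_ffun2_prod (T U : finType) (m : nat) (F : T -> U -> R) :
  \sum_(f : {ffun 'I_m -> T}) \sum_(g : {ffun 'I_m -> U})
    \prod_i F (f i) (g i) = (\sum_t \sum_u F t u) ^+ m.
Proof.
rewrite -sum_ffun_prod; apply: eq_bigr => f _.
by rewrite -(bigA_distr_bigA (fun i => F (f i))).
Qed.

Lemma one_sub_prod_le (T : finType) (B : T -> R) :
  (forall i, 0 <= B i <= 1) -> 1 - \prod_i B i <= \sum_i (1 - B i).
Proof.
move=> B01.
suff : 1 - \prod_i B i <= \sum_i (1 - B i) /\ 0 <= \prod_i B i <= 1 by case.
elim/big_ind2: _ => [|s x t y [] sx /andP[x0 x1] [] ty /andP[y0 y1]|i _].
- by rewrite subrr lexx ler01 lexx.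
- split; first by nra.
  by rewrite mulr_ge0//= mulr_ile1.
- by [].
Qed.

(** From [(1 - u) * expR u <= 1] and [1 <= (1 - u) * (1 + u + 2 * u ^+ 2)]. *)
Lemma expR_le_quad (u : R) : u <= 2^-1 -> expR u <= 1 + u + 2 * u ^+ 2.
Proof.
move=> u2; have := expR_ge1Dx (- u); rewrite expRN => h.
have e0 := expR_gt0 u.
have : (1 - u) * expR u <= (expR u)^-1 * expR u by rewrite ler_wpM2r// ltW.
rewrite mulVf ?gt_eqF//.
have : 0 < 1 + u + 2 * u ^+ 2 by nra.
have : 1 <= (1 - u) * (1 + u + 2 * u ^+ 2) by nra.
have : 0 < 1 - u by lra.
move=> c d _ f; rewrite -(ler_pM2l c); exact: le_trans f d.
Qed.

Section chernoff.
Variables (T U : finType) (rho X : T -> U -> R).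
Hypothesis rho0 : forall t u, 0 <= rho t u.
Hypothesis rho1 : \sum_t \sum_u rho t u = 1.
Hypothesis X1 : forall t u, `|X t u| <= 1.

(** Markov's inequality for [expR (l * sum)], with the choice [l = s / 4] which
    minimises the exponent [2 * l ^+ 2 - l * s]. The observable depends on two
    independent choices [t] and [u], where the law of [u] may depend on [t]. *)
Lemma chernoff (m : nat) (e s : R) : 0 <= s <= 2 ->
  \sum_t \sum_u rho t u * X t u <= e ->
  \sum_(f : {ffun 'I_m -> T}) \sum_(g : {ffun 'I_m -> U})
    ((e + s) * m%:R <= \sum_i X (f i) (g i))%R%:R * \prod_i rho (f i) (g i) <=
  expR (- (m%:R * s ^+ 2 / 8)).
Proof.
move=> /andP[s0 s2] Xe; pose l := s / 4.
have l2 : 0 <= l <= 2^-1 by rewrite /l; lra.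
apply: (@le_trans _ _ (\sum_(f : {ffun 'I_m -> T})
    \sum_(g : {ffun 'I_m -> U})
    \prod_i (rho (f i) (g i) * expR (l * (X (f i) (g i) - (e + s)))))).
  apply: ler_sum => f _; apply: ler_sum => g _; rewrite big_split/= mulrC.
  rewrite ler_wpM2l//; first by apply: prodr_ge0 => i _.
  rewrite -expR_sum -mulr_sumr sumrB sumr_const card_ord -[X in _ - X]mulr_natr.
  case: (leP ((e + s) * m%:R)) => [h|_]; last by rewrite mulr0n expR_ge0.
  have [l0 _] := andP l2; rewrite mulr1n -[leLHS]expR0 ler_expR mulr_ge0//.
  by rewrite subr_ge0.
rewrite (sum_ffun2_prod m (fun t u => rho t u * expR (l * (X t u - (e + s))))).
rewrite -mulrA -mulrN expRM_natl.
rewrite lerXn2r ?nnegrE ?expR_ge0//.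
  by do 2 (apply: sumr_ge0 => ? _); rewrite mulr_ge0// expR_ge0.
apply: (@le_trans _ _ (\sum_t \sum_u (rho t u * (1 + 2 * l ^+ 2) +
   l * (rho t u * X t u)) * expR (- (l * (e + s))))).
  apply: ler_sum => t _; apply: ler_sum => u _.
  rewrite mulrBr expRD mulrA ler_wpM2r ?expR_ge0//.
  have -> : rho t u * (1 + 2 * l ^+ 2) + l * (rho t u * X t u) =
    rho t u * (1 + l * X t u + 2 * l ^+ 2) by ring.
  rewrite ler_wpM2l//.
  have := X1 t u; rewrite ler_norml => /andP[X0 X2].
  apply: (le_trans (expR_le_quad _)); first by nra.
  have : (l * X t u) ^+ 2 <= l ^+ 2.
    rewrite exprMn ler_piMr ?sqr_ge0// -real_normK ?num_real// expr_le1//.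
  by lra.
under eq_bigr do rewrite -mulr_suml.
rewrite -mulr_suml.
under eq_bigr do rewrite big_split/= -mulr_suml -mulr_sumr.
rewrite big_split/= -mulr_suml -mulr_sumr rho1 mul1r.
apply: (@le_trans _ _ (expR (2 * l ^+ 2 + l * e) * expR (- (l * (e + s))))).
  rewrite ler_wpM2r ?expR_ge0//; apply: le_trans (expR_ge1Dx _).
  by have /andP[l0 _] := l2; have := ler_wpM2l l0 Xe; nra.
rewrite -expRD ler_expR /l; nra.
Qed.

End chernoff.

Definition sgb (b : bool) : R := if b then 1 else -1.

(** The law of a sign of mean [u / 2]. The factor 1/2 keeps both probabilities
    away from 0, so that their square roots are Lipschitz in [u]. *)
Definition tilt (u : R) (b : bool) : R := (1 + sgb b * u / 2) / 2.

Lemma tilt_ge u b : `|u| <= 1 -> 4^-1 <= tilt u b.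
Proof. by rewrite ler_norml /tilt /sgb; case: b; lra. Qed.

Lemma tilt_sum u : \sum_b tilt u b = 1.
Proof. by rewrite big_bool /tilt /sgb /=; lra. Qed.

Lemma tilt_mean u v : \sum_b tilt u b * (sgb b * v) = u * v / 2.
Proof. by rewrite big_bool /tilt /sgb /=; lra. Qed.

(** The sum is the Bhattacharyya coefficient of the two laws. One minus it is
    half the sum of the squared differences of the square roots, and these are
    at most the differences of the probabilities, as the square roots are at
    least 1/2. *)
Lemma tilt_affinity u v : `|u| <= 1 -> `|v| <= 1 ->
  1 - (u - v) ^+ 2 / 16 <= \sum_b Num.sqrt (tilt u b) * Num.sqrt (tilt v b) <= 1.
Proof.
move=> u1 v1.
have ge2 (w : R) b : `|w| <= 1 -> 2^-1 <= Num.sqrt (tilt w b).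
  move=> w1; rewrite -(@ger0_norm _ 2^-1)// -sqrtr_sqr ler_sqrt.
    by apply: le_trans (tilt_ge b w1); lra.
  by apply: le_trans (tilt_ge b w1).
have sq (w : R) b : `|w| <= 1 -> Num.sqrt (tilt w b) ^+ 2 = tilt w b.
  by move=> w1; rewrite sqr_sqrtr// (le_trans _ (tilt_ge b w1)).
have key b : 0 <= (Num.sqrt (tilt u b) - Num.sqrt (tilt v b)) ^+ 2 <=
    (tilt u b - tilt v b) ^+ 2.
  have -> : tilt u b - tilt v b =
      (Num.sqrt (tilt u b) - Num.sqrt (tilt v b)) *
      (Num.sqrt (tilt u b) + Num.sqrt (tilt v b)).
    by rewrite -subr_sqr !sq.
  rewrite sqr_ge0/= exprMn ler_peMr ?sqr_ge0//.
  rewrite expr_ge1 ?addr_ge0 ?sqrtr_ge0//.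
  have := ge2 u b u1; have := ge2 v b v1; lra.
have := key true; have := key false; rewrite !big_bool/=.
have := sq u true u1; have := sq u false u1.
have := sq v true v1; have := sq v false v1.
rewrite /tilt /sgb; move: (Num.sqrt _) (Num.sqrt _) (Num.sqrt _) (Num.sqrt _).
move=> a b c d; nra.
Qed.

(** The l_1 distance of two laws is at most twice their l_2 Hellinger distance
    (Cauchy-Schwarz applied to a difference of squares), and for product laws
    the square of the latter is at most the sum over the coordinates. This is
    what makes the bound Euclidean instead of additive in the coordinates. *)
Lemma product_tilt_l1 (m : nat) (u v : 'I_m -> R) :
  (forall i, `|u i| <= 1) -> (forall i, `|v i| <= 1) ->
  \sum_(z : {ffun 'I_m -> bool})
    `|\prod_i tilt (u i) (z i) - \prod_i tilt (v i) (z i)| <=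
  Num.sqrt (\sum_i (u i - v i) ^+ 2).
Proof.
move=> u1 v1.
have t0 (w : 'I_m -> R) : (forall i, `|w i| <= 1) ->
    forall i b, 0 <= tilt (w i) b.
  by move=> w1 i b; apply: le_trans (tilt_ge b (w1 i)).
pose r (w : 'I_m -> R) (z : {ffun 'I_m -> bool}) :=
  \prod_i Num.sqrt (tilt (w i) (z i)).
have r2 (w : 'I_m -> R) (z : {ffun 'I_m -> bool}) : (forall i, `|w i| <= 1) ->
    \prod_i tilt (w i) (z i) = r w z ^+ 2.
  move=> w1; rewrite -prodrXl; apply: eq_bigr => i _.
  by rewrite sqr_sqrtr// t0.
have r2s (w : 'I_m -> R) : (forall i, `|w i| <= 1) -> \sum_z r w z ^+ 2 = 1.
  move=> w1; under eq_bigr do rewrite -r2//.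
  rewrite -(bigA_distr_bigA (fun i => tilt (w i))) big1// => i _.
  exact: tilt_sum.
have ruv : 1 - (\sum_i (u i - v i) ^+ 2) / 16 <= \sum_z r u z * r v z.
  rewrite (eq_bigr (fun z : {ffun 'I_m -> bool} => \prod_i
    (Num.sqrt (tilt (u i) (z i)) * Num.sqrt (tilt (v i) (z i))))); last first.
    by move=> z _; rewrite big_split.
  rewrite -(bigA_distr_bigA
    (fun i b => Num.sqrt (tilt (u i) b) * Num.sqrt (tilt (v i) b)))/=.
  have := @one_sub_prod_le _
    (fun i => \sum_b Num.sqrt (tilt (u i) b) * Num.sqrt (tilt (v i) b)).
  move=> /(_ _)/le_trans H; rewrite lerBlDr addrC -lerBlDr; apply: H.
    move=> i; have /andP[_ ->] := tilt_affinity (u1 i) (v1 i).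
    by rewrite andbT sumr_ge0// => b _; rewrite mulr_ge0// sqrtr_ge0.
  rewrite mulr_suml; apply: ler_sum => i _.
  by have /andP[+ _] := tilt_affinity (u1 i) (v1 i); lra.
under eq_bigr do rewrite !r2// subr_sqr.
apply: le_trans (sum_abs_mul_le _ _) _.
rewrite -sqrtrM ?sumr_ge0// => [|i _]; last exact: sqr_ge0.
rewrite ler_sqrt ?sumr_ge0// => [|i _]; last exact: sqr_ge0.
set D := \sum_i (u i - v i) ^+ 2.
have D0 : 0 <= D by apply: sumr_ge0 => i _; exact: sqr_ge0.
have e1 : \sum_z (r u z - r v z) ^+ 2 <= D / 8.
  rewrite (eq_bigr (fun z => r u z ^+ 2 + r v z ^+ 2 - 2 * (r u z * r v z))).
    by rewrite sumrB big_split/= !r2s// -mulr_sumr; move: ruv; rewrite -/D; lra.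
  by move=> z _; ring.
have e2 : \sum_z (r u z + r v z) ^+ 2 <= 4.
  apply: (@le_trans _ _ (\sum_z (2 * r u z ^+ 2 + 2 * r v z ^+ 2))).
    by apply: ler_sum => z _; have := sqr_ge0 (r u z - r v z); nra.
  by rewrite big_split/= -!mulr_sumr !r2s//; lra.
apply: (@le_trans _ _ (D / 8 * 4)); last by lra.
by rewrite ler_pM// ?sumr_ge0// => i _; exact: sqr_ge0.
Qed.

End finite_sums.

(** * From correlated bounded functionals to a random partition *)

Section ramp.
Variable R : realType.

Definition clamp (s : R) : R := Num.max 0 (Num.min 1 s).

Lemma clamp_ge0 s : 0 <= clamp s.
Proof. by rewrite le_max lexx. Qed.

Lemma clamp_le1 s : clamp s <= 1.
Proof. by rewrite ge_max ler01 ge_min lexx. Qed.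

Lemma clamp_eq1 s : 1 <= s -> clamp s = 1.
Proof. by move=> s1; rewrite /clamp min_l// max_r. Qed.

Lemma clamp_gt0 s : 0 < clamp s -> 0 < s.
Proof. by rewrite lt_max ltxx/= lt_min => /andP[]. Qed.

Lemma clamp_lipschitz s t : `|clamp s - clamp t| <= `|s - t|.
Proof.
wlog st : s t / s <= t.
  by move=> H; case: (leP s t) => [|/ltW] /H//; rewrite distrC [leRHS]distrC.
rewrite ler_norml distrC [`|t - s|]ger0_norm ?subr_ge0//.
rewrite /clamp !maxElt !minElt.
by case: (ltP 1 s); case: (ltP 1 t); case: (ltP 0 s); case: (ltP 0 t);
  rewrite ?ltr01; lra.
Qed.

End ramp.

Section amplification.
Variables (R : realType) (I Om : finType) (pi : Om -> R) (h : Om -> I -> R).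
Variables (m : nat) (eta : R) (near far : rel I).
Hypothesis pi0 : forall o, 0 <= pi o.
Hypothesis pi1 : \sum_o pi o = 1.
Hypothesis h1 : forall o x, `|h o x| <= 1.
Hypothesis hvar : forall x, \sum_o pi o * h o x ^+ 2 = 2^-1.
Hypothesis hcov : forall x y, far x y ->
  \sum_o pi o * (h o x * h o y) <= 2^-1 - 2 * eta.
Hypothesis eta01 : 0 < eta <= 1.
Hypothesis far_near : forall x y y', ~~ near y y' -> far x y || far x y'.
Hypothesis m_large : 4 * #|I|%:R * expR (- (m%:R * eta ^+ 2 / 128)) <= 1.

Local Notation Samples := {ffun 'I_m -> Om}.
Local Notation Signs := {ffun 'I_m -> bool}.

Let weight (o : Samples) : R := \prod_i pi (o i).

(** For fixed samples, the law of the signs seen from [x]. *)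
Let mu (o : Samples) x (z : Signs) : R := \prod_i tilt (h (o i) x) (z i).

Let stat (o : Samples) (z : Signs) x : R :=
  \sum_i sgb R (z i) * h (o i) x.

(** Rises from 0 to 1 as the statistic goes from [(1/4 - eta/2) * m] to
    [(1/4 - eta/4) * m]. The mean of the statistic at [x] itself is [m / 4], and
    at points far from [x] it is at most [(1/4 - eta) * m]. *)
Let ramp (s : R) : R := clamp ((s - (4^-1 - eta / 2) * m%:R) * (4 / (eta * m%:R))).

(** Outcomes at which the points that pass the ramp form a cluster of small
    diameter; [psi] is set to 0 at the others, uniformly in the point, which
    does not harm the Lipschitz bound. *)
Let good (o : Samples) (z : Signs) : bool :=
  [forall y, forall y', (0 < ramp (stat o z y)) ==>
    (0 < ramp (stat o z y')) ==> near y y'].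

Let psi (oz : Samples * Signs) x : R :=
  weight oz.1 * mu oz.1 x oz.2 *
    (ramp (stat oz.1 oz.2 x) * (good oz.1 oz.2)%:R).

(** The joint law of one sample and its sign, seen from [x]. *)
Let rho x o b := pi o * tilt (h o x) b.

Let tilt0 o x b : 0 <= tilt (h o x) b.
Proof. by apply: le_trans (tilt_ge b (h1 o x)). Qed.

Let rho0 x o b : 0 <= rho x o b.
Proof. by rewrite mulr_ge0. Qed.

Let rho1 x : \sum_o \sum_b rho x o b = 1.
Proof.
by rewrite -pi1; apply: eq_bigr => o _; rewrite -mulr_sumr tilt_sum mulr1.
Qed.

Let rho_prod x o z : weight o * mu o x z = \prod_i rho x (o i) (z i).
Proof. by rewrite /weight /mu -big_split. Qed.

Let weight0 o : 0 <= weight o. Proof. exact: prodr_ge0. Qed.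

Let mu0 o x z : 0 <= mu o x z. Proof. exact: prodr_ge0. Qed.

Let rho_mean x y : \sum_o \sum_b rho x o b * (sgb R b * h o y) =
  (\sum_o pi o * (h o x * h o y)) / 2.
Proof.
rewrite mulr_suml; apply: eq_bigr => o _.
rewrite (eq_bigr (fun b => pi o * (tilt (h o x) b * (sgb R b * h o y)))).
  by rewrite -mulr_sumr tilt_mean; ring.
by move=> b _; rewrite /rho -mulrA.
Qed.

Let sgb1 b o y : `|sgb R b * h o y| <= 1.
Proof. by rewrite normrM /sgb; case: b; rewrite ?normrN normr1 mul1r. Qed.

Let m0 (x : I) : (0 < m)%N.
Proof.
rewrite lt0n; apply/negP => /eqP m0; have := m_large.
rewrite m0 !mul0r oppr0 expR0 mulr1 leNgt => /negP; apply.
have : 1 <= #|I|%:R :> R by rewrite ler1n; apply/card_gt0P; exists x.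
lra.
Qed.

Let self_low x : \sum_o \sum_z
    (stat o z x <= (4^-1 - eta / 4) * m%:R)%R%:R * \prod_i rho x (o i) (z i)
  <= 4^-1.
Proof.
have /andP[eta0 eta1] := eta01.
have H : \sum_o \sum_b rho x o b * (- (sgb R b * h o x)) <= - 4^-1.
  under eq_bigr do under eq_bigr do rewrite mulrN.
  under eq_bigr do rewrite sumrN.
  rewrite sumrN rho_mean lerN2.
  under eq_bigr do rewrite -expr2.
  by rewrite hvar; lra.
have b1 o b : `|- (sgb R b * h o x)| <= 1 by rewrite normrN.
have s02 : 0 <= eta / 4 <= 2 by lra.
have := chernoff (rho0 x) (rho1 x) b1 m s02 H => C.
apply: (@le_trans _ _ (expR (- (m%:R * (eta / 4) ^+ 2 / 8)))).
  apply: le_trans C; apply: ler_sum => o _; apply: ler_sum => z _.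
  rewrite sumrN (_ : (_ <= - _)%R = (stat o z x <= (4^-1 - eta / 4) * m%:R)).
    by [].
  by rewrite lerNr -mulNr opprD opprK.
have n1 : (1 <= #|I|)%N by apply/card_gt0P; exists x.
have n1' : 1 <= #|I|%:R :> R by rewrite ler1n.
have -> : m%:R * (eta / 4) ^+ 2 / 8 = m%:R * eta ^+ 2 / 128 by field.
have := m_large; have := expR_gt0 (- (m%:R * eta ^+ 2 / 128)).
by move: (expR _) => E E0; nra.
Qed.

Let other_high x y : far x y -> \sum_o \sum_z
    ((4^-1 - eta / 2) * m%:R <= stat o z y)%R%:R * \prod_i rho x (o i) (z i)
  <= (4 * #|I|%:R)^-1.
Proof.
have /andP[eta0 eta1] := eta01.
move=> xy; have H : \sum_o \sum_b rho x o b * (sgb R b * h o y) <= 4^-1 - eta.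
  by rewrite rho_mean; have := hcov xy; lra.
have s02 : 0 <= eta / 2 <= 2 by lra.
have := chernoff (rho0 x) (rho1 x) (fun o b => sgb1 b o y) m s02 H => C.
apply: (@le_trans _ _ (expR (- (m%:R * (eta / 2) ^+ 2 / 8)))).
  apply: le_trans C; apply: ler_sum => o _; apply: ler_sum => z _.
  by rewrite (_ : 4^-1 - eta + eta / 2 = 4^-1 - eta / 2)//; field.
have n1 : (1 <= #|I|)%N by apply/card_gt0P; exists x.
have n1' : 0 < #|I|%:R :> R by rewrite ltr0n.
rewrite -[leRHS]mul1r ler_pdivlMr ?mulr_gt0//.
rewrite mulrC; apply: le_trans m_large.
rewrite ler_wpM2l ?mulr_ge0// ler_expR lerN2.
have : 0 <= m%:R * eta ^+ 2 :> R by rewrite mulr_ge0 ?sqr_ge0.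
by rewrite expr_div_n mulrA; lra.
Qed.

Let ramp_gt0 (x : I) s : 0 < ramp s -> (4^-1 - eta / 2) * m%:R <= s.
Proof.
have /andP[eta0 _] := eta01.
move=> /clamp_gt0; rewrite pmulr_lgt0 ?subr_gt0; first by move/ltW.
by rewrite divr_gt0// mulr_gt0// ltr0n (m0 x).
Qed.

Let ramp_eq1 (x : I) s : (4^-1 - eta / 4) * m%:R <= s -> ramp s = 1.
Proof.
have /andP[eta0 _] := eta01.
have mp : 0 < m%:R :> R by rewrite ltr0n (m0 x).
move=> hs; apply: clamp_eq1; rewrite mulrA ler_pdivlMr ?mulr_gt0//.
by rewrite mul1r; nra.
Qed.

(** Mass is lost only if the statistic at [x] is low or if the outcome is not
    good. In the latter case one of two points that are not near each other is
    far from [x] and yet passes the ramp, so a union bound over the points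
    applies. *)
Let psi_mass x : 2^-1 <= \sum_oz psi oz x.
Proof.
rewrite -(pair_big predT predT (fun o z => psi (o, z) x))/=.
have tot : \sum_(o : Samples) \sum_(z : Signs) \prod_i rho x (o i) (z i) = 1.
  by rewrite sum_ffun2_prod rho1 expr1n.
have pw (o : Samples) (z : Signs) : \prod_i rho x (o i) (z i) - psi (o, z) x <=
    (stat o z x <= (4^-1 - eta / 4) * m%:R)%R%:R * \prod_i rho x (o i) (z i) +
    \sum_(y | far x y) ((4^-1 - eta / 2) * m%:R <= stat o z y)%R%:R *
      \prod_i rho x (o i) (z i).
  rewrite /psi/= rho_prod; set r := \prod_i _.
  have r0 : 0 <= r by apply: prodr_ge0.
  have S0 : 0 <= \sum_(y | far x y)
      ((4^-1 - eta / 2) * m%:R <= stat o z y)%R%:R * r.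
    by apply: sumr_ge0 => y _; rewrite mulr_ge0.
  case: (leP (stat o z x)) => [_|/ltW lo].
    rewrite mul1r lerD2l; apply: le_trans S0.
    by rewrite oppr_le0 mulr_ge0// mulr_ge0// clamp_ge0.
  rewrite mul0r add0r (ramp_eq1 x lo) mul1r.
  case: (boolP (good o z)) => [_|]; first by rewrite mulr1 subrr.
  rewrite mulr0 subr0 negb_forall => /existsP[y].
  rewrite negb_forall => /existsP[y']; rewrite !negb_imply => /and3P[yp y'p nn].
  have [f xf fp] : exists2 f, far x f & 0 < ramp (stat o z f).
    by case/orP: (far_near x nn) => ?; [exists y|exists y'].
  rewrite (bigD1 f)//= (ramp_gt0 x fp) mul1r lerDl.
  by apply: sumr_ge0 => w _; rewrite mulr_ge0.
(* One quarter of the mass for a low statistic at x, and one quarter for all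
   far points together, 1 / (4 * #|I|) each. *)
have H : 1 - \sum_o \sum_z psi (o, z) x <= 4^-1 + 4^-1.
  rewrite -[X in X - _]tot -sumrB.
  under eq_bigr do rewrite -sumrB.
  apply: (@le_trans _ _ (\sum_(o : Samples) \sum_(z : Signs)
    ((stat o z x <= (4^-1 - eta / 4) * m%:R)%R%:R * \prod_i rho x (o i) (z i) +
    \sum_(y | far x y) ((4^-1 - eta / 2) * m%:R <= stat o z y)%R%:R *
      \prod_i rho x (o i) (z i)))).
    by apply: ler_sum => o _; apply: ler_sum => z _; exact: pw.
  under eq_bigr do rewrite big_split/=.
  rewrite big_split/= lerD ?self_low//.
  under eq_bigr do rewrite exchange_big/=.
  rewrite exchange_big/=.
  apply: (@le_trans _ _ (\sum_(y | far x y) (4 * #|I|%:R)^-1)).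
    by apply: ler_sum => y /other_high.
  rewrite sumr_const -[leLHS]mulr_natl.
  have n1 : (1 <= #|I|)%N by apply/card_gt0P; exists x.
  have n1' : 0 < #|I|%:R :> R by rewrite ltr0n.
  rewrite invfM mulrCA -[leRHS]mulr1 ler_wpM2l// ler_pdivrMr// mul1r ler_nat.
  exact: max_card.
by lra.
Qed.

(** The density changes by [product_tilt_l1]. The ramp has slope of order
    [1 / m], and the statistic changes by at most [sqrt m] times the Euclidean
    norm of the change of [h] by Cauchy-Schwarz. *)
Let psi_lipschitz x y : \sum_oz `|psi oz x - psi oz y| <=
  (1 + 4 / eta) *
  \sum_o weight o * Num.sqrt (\sum_i (h (o i) x - h (o i) y) ^+ 2).
Proof.
have /andP[eta0 _] := eta01.
have mp : 0 < m%:R :> R by rewrite ltr0n (m0 x).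
rewrite -(pair_big predT predT (fun o z => `|psi (o, z) x - psi (o, z) y|))/=.
rewrite mulr_sumr; apply: ler_sum => o _.
set D := Num.sqrt _.
have D0 : 0 <= D by exact: sqrtr_ge0.
have rampL (z : Signs) : `|ramp (stat o z x) - ramp (stat o z y)| <= 4 / eta * D.
  apply: le_trans (clamp_lipschitz _ _) _.
  rewrite -mulrBl opprB subrKA normrM -sumrB.
  rewrite (eq_bigr (fun i => sgb R (z i) * (h (o i) x - h (o i) y))); last first.
    by move=> i _; rewrite mulrBr.
  have c0 : 0 <= 4 / (eta * m%:R) by rewrite divr_ge0// mulr_ge0// ltW.
  rewrite [X in _ * X]ger0_norm//.
  apply: (@le_trans _ _ (m%:R * D * (4 / (eta * m%:R)))); last first.
    by rewrite le_eqVlt; apply/orP; left; apply/eqP; field; rewrite !gt_eqF.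
  rewrite ler_wpM2r//.
  apply: le_trans (ler_norm_sum _ _ _) _; apply: le_trans (sum_abs_mul_le _ _) _.
  rewrite ler_wpM2r//.
  rewrite (eq_bigr (fun=> 1)); last first.
    by move=> i _; rewrite /sgb; case: (z i); rewrite ?sqrrN expr1n.
  rewrite sumr_const card_ord.
  rewrite -[leRHS]ger0_norm// -sqrtr_sqr ler_sqrt ?sqr_ge0//.
  by rewrite ler_eXnr// ler1n (m0 x).
rewrite mulrCA.
apply: (@le_trans _ _ (\sum_(z : Signs) weight o *
    (`|mu o x z - mu o y z| + mu o y z * (4 / eta * D)))).
  apply: ler_sum => z _; rewrite /psi/= -!mulrA -mulrBr normrM ger0_norm//.
  rewrite ler_wpM2l// !mulrA -mulrBl normrM.
  rewrite [X in _ * X]ger0_norm// -[leRHS]mulr1.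
  rewrite ler_pM// ?lern1 ?leq_b1//.
  have -> : mu o x z * ramp (stat o z x) - mu o y z * ramp (stat o z y) =
    (mu o x z - mu o y z) * ramp (stat o z x) +
    mu o y z * (ramp (stat o z x) - ramp (stat o z y)) by ring.
  apply: le_trans (ler_normD _ _) _; rewrite !normrM lerD//.
    by rewrite [X in _ * X]ger0_norm ?clamp_ge0// ler_piMr// clamp_le1.
  by rewrite [`|mu _ _ _|]ger0_norm// -!mulrA ler_wpM2l// mulrA.
rewrite -mulr_sumr ler_wpM2l// big_split/= -mulr_suml.
have -> : \sum_z mu o y z = 1.
  rewrite -(bigA_distr_bigA (fun i => tilt (h (o i) y))) big1// => i _.
  exact: tilt_sum.
rewrite mul1r (_ : (1 + 4 / eta) * D = D + 4 / eta * D) ?lerD2r; last by ring.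
exact: (product_tilt_l1 (fun i => h1 (o i) x) (fun i => h1 (o i) y)).
Qed.

(** Independent copies of a functional that decorrelates far points turn into a
    random partition; [m] has to be of the order of [ln #|I|] only. *)
Lemma correlated_functionals_partition :
  exists P : {ffun I -> {set I}} -> R, [/\ forall g, 0 <= P g,
    \sum_g P g = 1,
    forall g, 0 < P g -> forall x y, g x = g y -> near x y &
    forall x y, \sum_(g : {ffun I -> {set I}} | g x != g y) P g <=
      2 * (1 + 4 / eta) * \sum_(o : {ffun 'I_m -> Om}) (\prod_i pi (o i)) *
        Num.sqrt (\sum_i (h (o i) x - h (o i) y) ^+ 2)].
Proof.
have psi0 oz x : 0 <= psi oz x.
  by rewrite mulr_ge0 ?mulr_ge0// clamp_ge0.
have psin oz x y : 0 < psi oz x -> 0 < psi oz y -> near x y.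
  rewrite /psi; case: (boolP (good _ _)) => [gd|_]; last by rewrite !mulr0 ltxx.
  have w0 u : 0 <= weight oz.1 * mu oz.1 u oz.2 by rewrite mulr_ge0.
  rewrite !mulr1.
  have rp u : 0 < weight oz.1 * mu oz.1 u oz.2 * ramp (stat oz.1 oz.2 u) ->
      0 < ramp (stat oz.1 oz.2 u).
    rewrite !lt_def clamp_ge0 andbT => /andP[+ _].
    by rewrite mulf_eq0 negb_or => /andP[].
  move=> /rp xp /rp yp.
  by have /forallP/(_ x)/forallP/(_ y) := gd; rewrite xp yp.
have [P [P0 P1 Pn Ps]] := carving_partition psi0 psin psi_mass.
exists P; split=> // x y; apply: le_trans (Ps x y) _.
by rewrite -mulrA ler_wpM2l// psi_lipschitz.
Qed.

End amplification.

(** * Dyadic sums with the tail of a p-stable law *)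

Section powers_of_two.
Variable R : realType.

Lemma ln2_ge : 2^-1 <= ln 2 :> R.
Proof.
rewrite -[leLHS]expRK ler_ln ?posrE ?expR_gt0//.
by apply: le_trans (expR_le_quad (lexx _)) _; lra.
Qed.

Lemma ln2_le : ln 2 <= 1 :> R.
Proof.
rewrite -[leRHS]expRK ler_ln ?posrE ?expR_gt0//.
by apply: le_trans (expR_ge1Dx _); lra.
Qed.

Lemma pow2_ge (s : R) : 0 <= s -> 1 + s / 2 <= 2 `^ s.
Proof.
move=> s0; rewrite /powR ifF; last by apply/negbTE; rewrite pnatr_eq0.
apply: le_trans (expR_ge1Dx _); rewrite lerD2l ler_wpM2l//; exact: ln2_ge.
Qed.

(** Convexity of the exponential between 0 and [ln 2]. *)
Lemma pow2_le (s : R) : 0 <= s <= 1 -> 2 `^ s <= 1 + s.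
Proof.
move=> /andP[s0 s1].
have := @convex_expR R (Itv01 s0 s1) (ln 2) 0.
rewrite !convRE/= expR0 mulr0 addr0 lnK ?posrE// /unstable.onem => h.
rewrite /powR ifF; last by apply/negbTE; rewrite pnatr_eq0.
by apply: le_trans h _; lra.
Qed.

End powers_of_two.

Section dyadic_sums.
Variables (R : realType) (p : R).
Hypothesis p12 : 1 < p <= 2.

Let s := 2 - p.
Let r := p - 1.
Let w : R := (2 `^ p)^-1.

Let s01 : 0 <= s <= 1. Proof. by have /andP[? ?] := p12; rewrite /s; apply/andP; split; lra. Qed.
Let r01 : 0 < r <= 1. Proof. by have /andP[? ?] := p12; rewrite /r; apply/andP; split; lra. Qed.
Let w0 : 0 < w. Proof. by rewrite invr_gt0 powR_gt0. Qed.

Let pow2sE : 2 `^ s = 4 * w.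
Proof.
rewrite /s /w powRB ?powR_mulrn//; last by apply/implyP.
by congr (_ / _); rewrite expr2; lra.
Qed.

Let pow2rE : 2 * w = (2 `^ r)^-1.
Proof.
rewrite /w /r powRB ?powRr1//; last by apply/implyP.
by rewrite invf_div.
Qed.

Let w_bounds : [/\ 4^-1 <= w, w <= 2^-1, 4 * w <= 1 + s & 1 + s / 2 <= 4 * w].
Proof.
have /andP[s0 s1] := s01.
have := pow2_le s01; have := pow2_ge s0; rewrite pow2sE => h1 h2.
by split; lra.
Qed.

Let w_r : 2 * w <= 1 - r / 3.
Proof.
have /andP[r0 r1] := r01.
rewrite pow2rE; have h := pow2_ge (ltW r0).
apply: (@le_trans _ _ (1 + r / 2)^-1).
  by rewrite lef_pV2 ?posrE ?powR_gt0//; lra.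
rewrite -[leLHS]mul1r ler_pdivrMr; nra.
Qed.

Let powM2 (y : R) : 0 <= y -> w * (2 * y) `^ p = y `^ p.
Proof.
by move=> y0; rewrite powRM// mulrA mulVf ?mul1r// gt_eqF// powR_gt0.
Qed.

Let sq_le_pow (y : R) : 0 <= y <= 1 -> y ^+ 2 <= y `^ p.
Proof.
have /andP[p1 p2] := p12.
move=> /andP[]; rewrite le_eqVlt => /predU1P[<- _|y0 y1].
  by rewrite expr0n/= powR_ge0.
by rewrite -(powR_mulrn 2 (ltW y0)) ger_powR// y0.
Qed.

Let le_pow (y : R) : 1 <= y -> y <= y `^ p.
Proof. by have /andP[p1 p2] := p12; move=> y1; apply: le1r_powR => //; rewrite ltW. Qed.

(** Level [l] of a coordinate of size [y] contributes a term of size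
    [2 ^ (- l) * y] for the low levels and [2 ^ l * y] for the high ones; high
    level [l] is active with probability proportional to [s * w ^ l], where
    [w = 2 ^ (- p)]. The energies collect the second moments of the terms of
    size at most 1, the overflows the first moments of the others. The factor
    [s = 2 - p] keeps the high energy bounded as p tends to 2, where all jumps
    disappear and a walk of finite variance remains. The low levels only prevent
    the cosine of a large multiple of [2 * pi] from being mistaken for 1. *)
Definition low_energy (K : nat) (y : R) : R :=
  \sum_(l < K) ((2^-1) ^+ l * y) ^+ 2 * ((2^-1) ^+ l * y <= 1)%R%:R.

Definition low_overflow (K : nat) (y : R) : R :=
  \sum_(l < K) ((2^-1) ^+ l * y) * (1 < (2^-1) ^+ l * y)%R%:R.

Definition high_energy (K : nat) (y : R) : R :=
  \sum_(l < K) (s * w ^+ l) * ((2 ^+ l * y) ^+ 2 * (2 ^+ l * y <= 1)%R%:R).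

Definition high_overflow (K : nat) (y : R) : R :=
  \sum_(l < K) (s * w ^+ l) * ((2 ^+ l * y) * (1 < 2 ^+ l * y)%R%:R).

Lemma low_energyS K y : low_energy K.+1 y =
  y ^+ 2 * (y <= 1)%R%:R + low_energy K (y / 2).
Proof.
rewrite /low_energy big_ord_recl expr0 !mul1r; congr (_ + _).
apply: eq_bigr => i _; rewrite /bump/= ?add1n.
by have -> : 2^-1 ^+ i.+1 * y = 2^-1 ^+ i * (y / 2) by rewrite exprSr; ring.
Qed.

Lemma low_overflowS K y : low_overflow K.+1 y =
  y * (1 < y)%R%:R + low_overflow K (y / 2).
Proof.
rewrite /low_overflow big_ord_recl expr0 !mul1r; congr (_ + _).
apply: eq_bigr => i _; rewrite /bump/= ?add1n.
by have -> : 2^-1 ^+ i.+1 * y = 2^-1 ^+ i * (y / 2) by rewrite exprSr; ring.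
Qed.

Lemma high_energyS K y : high_energy K.+1 y =
  s * (y ^+ 2 * (y <= 1)%R%:R) + w * high_energy K (2 * y).
Proof.
rewrite /high_energy big_ord_recl !expr0 !mul1r mulr1; congr (_ + _).
rewrite mulr_sumr; apply: eq_bigr => i _; rewrite /bump/= ?add1n.
have -> : 2 ^+ i.+1 * y = 2 ^+ i * (2 * y) by rewrite exprSr; ring.
by rewrite [w ^+ i.+1]exprS; ring.
Qed.

Lemma high_overflowS K y : high_overflow K.+1 y =
  s * (y * (1 < y)%R%:R) + w * high_overflow K (2 * y).
Proof.
rewrite /high_overflow big_ord_recl !expr0 !mul1r mulr1; congr (_ + _).
rewrite mulr_sumr; apply: eq_bigr => i _; rewrite /bump/= ?add1n.
have -> : 2 ^+ i.+1 * y = 2 ^+ i * (2 * y) by rewrite exprSr; ring.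
by rewrite [w ^+ i.+1]exprS; ring.
Qed.

Lemma low_energy_ge0 K y : 0 <= low_energy K y.
Proof. by apply: sumr_ge0 => l _; rewrite mulr_ge0// sqr_ge0. Qed.

Lemma high_energy_ge0 K y : 0 <= high_energy K y.
Proof.
have /andP[s0 _] := s01; apply: sumr_ge0 => l _.
apply: mulr_ge0; first by rewrite mulr_ge0// exprn_ge0// ltW.
by apply: mulr_ge0 => //; exact: sqr_ge0.
Qed.

Lemma low_energy_le K y : 0 <= y -> low_energy K y <= 4 / 3 * Num.min 1 (y ^+ 2).
Proof.
elim: K y => [|K IH] y y0.
  by rewrite /low_energy big_ord0 mulr_ge0// le_min ler01 sqr_ge0.
rewrite low_energyS; have := IH (y / 2) (divr_ge0 y0 (ler0n _ _)).
move: (low_energy _ _) => L; rewrite !minElt.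
case: (leP y 1) => y1; rewrite ?mulr1 ?mulr0 ?add0r.
  have -> : (1 < y ^+ 2) = false by rewrite ltNge expr_le1//= y1.
  by case: ltP => ?; nra.
have -> : 1 < y ^+ 2 by rewrite expr_gt1.
by case: ltP => h; nra.
Qed.

Lemma low_overflow_le K y : 0 <= y -> low_overflow K y <= 2 * y * (1 < y)%R%:R.
Proof.
elim: K y => [|K IH] y y0; first by rewrite /low_overflow big_ord0 !mulr_ge0.
rewrite low_overflowS; have := IH (y / 2) (divr_ge0 y0 (ler0n _ _)).
move: (low_overflow _ _) => L.
case: (ltP 1 y) => y1; case: (ltP 1 (y / 2)) => y2;
  rewrite ?mulr1 ?mulr0 ?add0r; lra.
Qed.

Lemma low_energy_ge K y : 2^-1 <= y <= 2 ^+ K -> 4^-1 <= low_energy K.+1 y.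
Proof.
elim: K y => [|K IH] y /andP[y2 yK]; rewrite low_energyS.
  have := low_energy_ge0 0 (y / 2).
  by rewrite expr0 in yK; rewrite yK mulr1; nra.
case: (leP y 1) => y1; last first.
  rewrite mulr0 add0r; apply: IH; rewrite ler_pdivrMr// -exprSr yK andbT.
  by lra.
have := low_energy_ge0 K.+1 (y / 2).
by rewrite mulr1; nra.
Qed.

Lemma high_energy_gt1 K y : 1 < y -> high_energy K y = 0.
Proof.
elim: K y => [|K IH] y y1; first by rewrite /high_energy big_ord0.
by rewrite high_energyS leNgt y1 !mulr0 add0r IH ?mulr0//; lra.
Qed.

(** The subtracted square makes the induction close: with it the step amounts to
    [s + 2 <= 2 * 2 `^ s], whereas without it the step would require
    [s <= 0]. *)
Lemma high_energy_le K y : 0 <= y <= 1 ->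
  high_energy K y <= 3 * y `^ p - 2 * y ^+ 2.
Proof.
have [w1 w2 w3 w4] := w_bounds; have /andP[s0 s1] := s01.
elim: K y => [|K IH] y /andP[y0 y1].
  rewrite /high_energy big_ord0.
  by have := @sq_le_pow y; rewrite y0 y1 => /(_ isT); have := sqr_ge0 y; nra.
rewrite high_energyS y1 mulr1.
have y2p : y ^+ 2 <= y `^ p by apply: sq_le_pow; rewrite y0.
case: (leP (2 * y) 1) => y2; last first.
  by rewrite high_energy_gt1// mulr0 addr0; have := sqr_ge0 y; nra.
have y20 : 0 <= 2 * y by rewrite mulr_ge0.
have := IH (2 * y); rewrite y20 y2 => /(_ isT) h.
have {h} := ler_wpM2l (ltW w0) h.
rewrite mulrBr mulrCA powM2// => h.
apply: (le_trans (lerD (lexx _) h)).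
have := sqr_ge0 y; nra.
Qed.

(** The step uses [2 `^ s <= 1 + s], the reverse of the inequality behind the
    upper bound; together they show that the factor [s] is the right one. *)
Lemma high_energy_ge K y : 0 <= y <= 1 -> 1 <= 2 ^+ K * y ->
  y `^ p - y ^+ 2 <= high_energy K y.
Proof.
have [w1 w2 w3 w4] := w_bounds; have /andP[s0 s1] := s01.
elim: K y => [|K IH] y /andP[y0 y1].
  rewrite expr0 mul1r => yge; have -> : y = 1 by apply/eqP; rewrite eq_le y1.
  by rewrite powR1 expr1n subrr high_energy_ge0.
move=> yK; rewrite high_energyS y1 mulr1.
have y20 : 0 <= 2 * y by rewrite mulr_ge0.
case: (leP (2 * y) 1) => y2.
  have := IH (2 * y); rewrite y20 y2 mulrA -exprSr yK => /(_ isT isT) h.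
  have {h} := ler_wpM2l (ltW w0) h.
  rewrite mulrBr powM2// => h.
  apply: le_trans (lerD (lexx _) h).
  have := sqr_ge0 y; nra.
rewrite high_energy_gt1// mulr0 addr0.
rewrite lerBlDr -powM2//.
have : (2 * y) `^ p <= (2 * y) ^+ 2.
  rewrite -powR_mulrn// ler_powR ?(ltW y2)//.
  by have /andP[_] := p12.
move=> h; apply: (@le_trans _ _ (w * (2 * y) ^+ 2)).
  by rewrite ler_wpM2l// ltW.
have := sqr_ge0 y; nra.
Qed.

(** A geometric series of ratio [2 * w = 2 `^ (1 - p)], which is at most
    [1 - (p - 1) / 3]; its sum is the source of the factor [1 / (p - 1)]. *)
Lemma high_overflow_le K y : 0 <= y ->
  high_overflow K y <= 3 / r * Num.min y (y `^ p).
Proof.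
have [w1 w2 w3 w4] := w_bounds; have /andP[s0 s1] := s01.
have /andP[r0 r1] := r01.
have c0 : 0 <= 3 / r by rewrite divr_ge0// ltW.
elim: K y => [|K IH] y y0.
  by rewrite /high_overflow big_ord0 mulr_ge0// le_min y0 powR_ge0.
have y20 : 0 <= 2 * y by rewrite mulr_ge0.
rewrite high_overflowS; have := ler_wpM2l (ltW w0) (IH (2 * y) y20).
move: (high_overflow _ _) => L h.
have h1 : w * L <= 3 / r * (2 * w * y).
  apply: (le_trans h); rewrite mulrCA ler_wpM2l//.
  rewrite (_ : 2 * w * y = w * (2 * y)); last by ring.
  by rewrite ler_wpM2l ?(ltW w0)// ge_min lexx.
have h2 : w * L <= 3 / r * y `^ p.
  apply: (le_trans h); rewrite mulrCA ler_wpM2l// -(powM2 y0).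
  by rewrite ler_wpM2l ?(ltW w0)// ge_min lexx orbT.
have wy : 3 / r * (2 * w * y) <= 3 / r * y - y.
  have : 3 / r * (2 * w * y) <= 3 / r * ((1 - r / 3) * y).
    by rewrite ler_wpM2l// ler_wpM2r//.
  move/le_trans; apply; rewrite le_eqVlt; apply/orP; left; apply/eqP.
  by field; rewrite gt_eqF.
case: (ltP 1 y) => y1.
  rewrite mulr1 min_l; last by rewrite le_pow// ltW.
  by nra.
rewrite !mulr0 add0r /Num.min; case: ifP => _ //.
by apply: (le_trans h1); apply: (le_trans wy); rewrite gerBl.
Qed.

Lemma min1sq_le (y : R) : 0 <= y -> Num.min 1 (y ^+ 2) <= y `^ p.
Proof.
move=> y0; case: (leP y 1) => y1.
  by apply: le_trans (sq_le_pow _); rewrite ?y0// ge_min lexx orbT.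
by rewrite ge_min (le_trans (ltW y1))// le_pow// ltW.
Qed.

Lemma energy_le K y : 0 <= y ->
  2^-1 * low_energy K y + 2^-1 * high_energy K y <= 3 * y `^ p.
Proof.
move=> y0; have := low_energy_le K y0; have := min1sq_le y0.
case: (leP y 1) => y1.
  have := @high_energy_le K y; rewrite y0 y1 => /(_ isT).
  by have := sqr_ge0 y; have := powR_ge0 y p; nra.
by rewrite high_energy_gt1//; have := powR_ge0 y p; nra.
Qed.

Lemma overflow_le K y : 0 <= y ->
  2^-1 * low_overflow K y + 2^-1 * high_overflow K y <= 3 / r * y `^ p.
Proof.
move=> y0; have := low_overflow_le K y0; have := high_overflow_le K y0.
have /andP[r0 r1] := r01.
have r3 : 3 <= 3 / r by rewrite ler_pdivlMr//; nra.
have yp := powR_ge0 y p.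
have m1 : 3 / r * Num.min y (y `^ p) <= 3 / r * y `^ p.
  by rewrite ler_wpM2l ?ge_min ?lexx ?orbT//; lra.
case: (ltP 1 y) => y1; rewrite ?mulr1 ?mulr0.
  by have := le_pow (ltW y1); nra.
by nra.
Qed.

(** The hypotheses say that there are enough levels for the size [y]: one low
    level brings [y] below 1, and one high level brings it above 1. *)
Lemma energy_ge K y : 0 <= y -> y <= 2 ^+ K -> (y = 0 \/ 1 <= 2 ^+ K * y) ->
  8^-1 * Num.min 1 (y `^ p) <=
  2^-1 * low_energy K.+1 y + 2^-1 * high_energy K.+1 y.
Proof.
move=> y0 yK yor.
have L0 := low_energy_ge0 K.+1 y; have H0 := high_energy_ge0 K.+1 y.
have yp := powR_ge0 y p.
case: (leP y 1) => y1.
  have le2 : Num.min 1 (y `^ p) <= y `^ p by rewrite ge_min lexx orbT.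
  case: yor => [y00|yK1].
    have : y `^ p = 0 by rewrite y00 powR0// gt_eqF//; have /andP[] := p12; lra.
    by nra.
  have := @high_energy_ge K.+1 y; rewrite y0 y1 => /(_ isT).
  have -> : 1 <= 2 ^+ K.+1 * y by rewrite exprS; nra.
  move=> /(_ isT).
  have : y ^+ 2 <= low_energy K.+1 y.
    by rewrite low_energyS y1 mulr1 lerDl low_energy_ge0.
  by nra.
have le1 : Num.min 1 (y `^ p) <= 1 by rewrite ge_min lexx.
have := @low_energy_ge K y; rewrite yK andbT => /(_ _) h.
have : 4^-1 <= low_energy K.+1 y by apply: h; lra.
by nra.
Qed.

End dyadic_sums.

(** * Cosines of random signed sums *)

Section trigonometric_bounds.
Variable R : realType.

Lemma lipschitz1_of_derivative (f df : R -> R) :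
  (forall x : R, is_derive x 1 f (df x)) -> (forall x, `|df x| <= 1) ->
  forall x y, `|f x - f y| <= `|x - y|.
Proof.
move=> fd df1 x y.
wlog xy : x y / x <= y.
  by move=> H; case: (leP x y) => [|/ltW] /H//; rewrite distrC [leRHS]distrC.
have [c _ E] := MVT_segment xy (fun t _ => fd t)
  (derivable_within_continuous (fun t _ => @ex_derive _ _ _ _ _ _ _ (fd t))).
by rewrite distrC E normrM [leRHS]distrC ler_piMl.
Qed.

Lemma cos_lipschitz (x y : R) : `|cos x - cos y| <= `|x - y|.
Proof.
apply: (@lipschitz1_of_derivative cos (fun x => - sin x)) => {x y} x.
by rewrite normrN sin_max.
Qed.

Lemma sin_lipschitz (x y : R) : `|sin x - sin y| <= `|x - y|.
Proof.
by apply: (@lipschitz1_of_derivative sin cos) => {x y} x; exact: cos_max.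
Qed.

(** [1 - cos u = 2 * sin (u / 2) ^+ 2], and [sin (u / 2)] is at least
    [cos (1 / 2) * u / 2], where [2 * cos (1 / 2) ^+ 2 - 1 = cos 1 > 0]. *)
Lemma one_sub_cos_ge (u : R) : `|u| <= 1 -> u ^+ 2 / 4 <= 1 - cos u.
Proof.
rewrite -(cos_norm u) -(@real_normK _ u) ?num_real//.
move: `|u| (normr_ge0 u) => {}u u0 u1.
have pi2 := pi_ge2 R.
have c2 : 2^-1 <= cos (2^-1 : R) ^+ 2.
  have := cos1_gt0 R; rewrite (_ : cos 1 = cos (2^-1 *+ 2)).
    by rewrite cos_mulr2n -[_ ^+ 2 *+ 2]mulr_natr; lra.
  by congr cos; rewrite -[RHS]mulr_natr; lra.
have c0 : 0 < cos (2^-1 : R) by apply: cos_gt0_pihalf; apply/andP; split; lra.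
have u2 : 0 <= u / 2 by lra.
have [c /[!in_itv]/= /andP[c1 c3] E] :=
  MVT_segment u2 (fun t _ => is_derive_sin t)
    (derivable_within_continuous
      (fun t _ => @ex_derive _ _ _ _ _ _ _ (is_derive_sin t))).
rewrite sin0 !subr0 in E.
have cc : cos (2^-1) <= cos c.
  move: c3; rewrite le_eqVlt => /predU1P[->|c3].
    move: u1; rewrite le_eqVlt => /predU1P[->|u1]; first by rewrite mul1r.
    by apply/ltW; rewrite ltr_cos ?in_itv/= ?andbT; lra.
  by apply/ltW; rewrite ltr_cos ?in_itv/=; lra.
have -> : 1 - cos u = 2 * sin (u / 2) ^+ 2.
  have -> : cos u = cos ((u / 2) *+ 2).
    by congr cos; rewrite -[RHS]mulr_natr; lra.
  by rewrite cos_mulr2n -[_ ^+ 2 *+ 2]mulr_natr cos2sin2; lra.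
rewrite E exprMn.
have : cos (2^-1 : R) ^+ 2 <= cos c ^+ 2 by rewrite lerXn2r ?nnegrE//; lra.
have := sqr_ge0 (u / 2); nra.
Qed.

End trigonometric_bounds.

Section product_expectations.
Variables (R : realType) (J T : finType) (w : J -> T -> R).
Hypothesis w1 : forall j, \sum_t w j t = 1.

Lemma product_total : \sum_(f : {ffun J -> T}) \prod_j w j (f j) = 1.
Proof. by rewrite -(bigA_distr_bigA w) big1. Qed.

Let prod_pick (f : {ffun J -> T}) i (G : T -> R) :
  \prod_j (if j == i then G (f j) else 1) = G (f i).
Proof. by rewrite -big_mkcond big_pred1_eq. Qed.

Lemma product_marginal (i : J) (G : T -> R) :
  \sum_(f : {ffun J -> T}) (\prod_j w j (f j)) * G (f i) = \sum_t w i t * G t.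
Proof.
under eq_bigr do rewrite -(prod_pick _ i G) -big_split/=.
rewrite -(bigA_distr_bigA (fun j t => w j t * (if j == i then G t else 1))).
rewrite (bigD1 i)//= eqxx [X in _ * X]big1 ?mulr1// => j /negPf->.
by under eq_bigr do rewrite mulr1.
Qed.

Lemma product_uncorrelated (i k : J) (G H : T -> R) : i != k ->
  \sum_t w i t * G t = 0 ->
  \sum_(f : {ffun J -> T}) (\prod_j w j (f j)) * (G (f i) * H (f k)) = 0.
Proof.
move=> ik G0.
under eq_bigr do
  rewrite -(prod_pick _ i G) -(prod_pick _ k H) -!big_split/=.
rewrite -(bigA_distr_bigA (fun j t => w j t *
  ((if j == i then G t else 1) * (if j == k then H t else 1)))).
rewrite (bigD1 i)//= eqxx (negPf ik).
under eq_bigr do rewrite mulr1.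
by rewrite G0 mul0r.
Qed.

End product_expectations.

Section random_signs.
Variables (R : realType) (J : finType) (q : J -> R).
Hypothesis q01 : forall j, 0 <= q j <= 2^-1.

(** A lazy sign: [None] means that the term is absent. *)
Definition step (o : option bool) : R := if o is Some b then sgb R b else 0.

Definition step_law (j : J) (o : option bool) : R :=
  if o is Some _ then q j / 2 else 1 - q j.

Lemma sum_option_bool (V : nmodType) (F : option bool -> V) :
  \sum_o F o = F None + (F (Some true) + F (Some false)).
Proof.
rewrite (bigD1 None)//= (bigD1 (Some true))//= (bigD1 (Some false))//=.
by rewrite big1 ?addr0// => -[[]|].
Qed.

Lemma step_law_ge0 j o : 0 <= step_law j o.
Proof. by have := q01 j; case: o => [b|] /= /andP[]; lra. Qed.

Lemma step_law_sum j : \sum_o step_law j o = 1.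
Proof. by rewrite sum_option_bool/=; lra. Qed.

Definition walk_law (t : {ffun J -> option bool}) : R := \prod_j step_law j (t j).

Lemma walk_law_ge0 t : 0 <= walk_law t.
Proof. by apply: prodr_ge0 => j _; exact: step_law_ge0. Qed.

Lemma walk_law_sum : \sum_t walk_law t = 1.
Proof. exact: (product_total step_law_sum). Qed.

Definition walk (a : J -> R) (t : {ffun J -> option bool}) : R :=
  \sum_j step (t j) * a j.

Lemma walkB a b t : walk a t - walk b t = walk (fun j => a j - b j) t.
Proof. by rewrite /walk -sumrB; apply: eq_bigr => j _; rewrite mulrBr. Qed.

(** Distinct steps are uncorrelated because each has mean 0. *)
Lemma walk_variance a : \sum_t walk_law t * walk a t ^+ 2 = \sum_j q j * a j ^+ 2.
Proof.
have -> : \sum_t walk_law t * walk a t ^+ 2 = \sum_j \sum_k (a j * a k) *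
    \sum_t walk_law t * (step (t j) * step (t k)).
  under eq_bigr => t _.
    rewrite expr2 /walk mulr_suml mulr_sumr.
    under eq_bigr do rewrite mulr_sumr mulr_sumr.
  over.
  rewrite exchange_big/=; apply: eq_bigr => j _.
  rewrite exchange_big/=; apply: eq_bigr => k _.
  by rewrite mulr_sumr; apply: eq_bigr => t _; ring.
apply: eq_bigr => j _; rewrite (bigD1 j)//= [X in _ + X]big1 ?addr0 => [|k kj].
  have := product_marginal step_law_sum j (fun o => step o ^+ 2).
  rewrite sum_option_bool/= /sgb => h.
  have -> : \sum_t walk_law t * (step (t j) * step (t j)) = q j.
    under eq_bigr do rewrite -expr2.
    by rewrite /walk_law h; field.
  by rewrite -expr2 mulrC.
rewrite /walk_law product_uncorrelated ?mulr0 1?eq_sym//.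
by rewrite sum_option_bool/= /sgb; lra.
Qed.

Lemma walk_abs_mean_le a :
  \sum_t walk_law t * `|walk a t| <= \sum_j q j * `|a j|.
Proof.
apply: (@le_trans _ _ (\sum_t walk_law t * \sum_j `|step (t j)| * `|a j|)).
  apply: ler_sum => t _; rewrite ler_wpM2l ?walk_law_ge0//.
  by apply: le_trans (ler_norm_sum _ _ _) _; apply: ler_sum => j _; rewrite normrM.
under eq_bigr do rewrite mulr_sumr.
rewrite exchange_big/=; apply: ler_sum => j _.
under eq_bigr do rewrite mulrA.
rewrite -mulr_suml ler_wpM2r//.
rewrite /walk_law (product_marginal step_law_sum j (fun o => `|step o|)).
rewrite sum_option_bool/= /sgb normrN normr1 normr0; lra.
Qed.

Definition cis (x : R) : R[i] := Complex (cos x) (sin x).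

Lemma cisD x y : cis (x + y) = cis x * cis y.
Proof.
rewrite /cis cosD sinD; apply/eqP; rewrite eq_complex/=.
by apply/andP; split; apply/eqP; ring.
Qed.

Lemma cis_sum (K : finType) (F : K -> R) : cis (\sum_k F k) = \prod_k cis (F k).
Proof.
apply: (big_morph cis cisD).
by rewrite /cis cos0 sin0.
Qed.

Lemma Re_sum (K : finType) (F : K -> R[i]) :
  complex.Re (\sum_k F k) = \sum_k complex.Re (F k).
Proof. by apply: (big_morph (@complex.Re R)) => // -[a b] [c d]. Qed.

(** The real part of the characteristic function of a sum of independent
    symmetric terms, which is the product of the real characteristic functions
    of the terms. *)
Lemma walk_cos_mean a :
  \sum_t walk_law t * cos (walk a t) = \prod_j (1 - q j * (1 - cos (a j))).
Proof.
have -> : \sum_t walk_law t * cos (walk a t) =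
    complex.Re (\sum_t (walk_law t)%:C%C * cis (walk a t)).
  rewrite Re_sum; apply: eq_bigr => t _ /=.
  by rewrite mul0r subr0.
have -> : \sum_t (walk_law t)%:C%C * cis (walk a t) =
    (\prod_j (1 - q j * (1 - cos (a j))))%:C%C.
  rewrite (eq_bigr (fun t : {ffun J -> option bool} => \prod_j
      ((step_law j (t j))%:C%C * cis (step (t j) * a j)))); last first.
    by move=> t _; rewrite /walk cis_sum rmorph_prod big_split.
  rewrite -(bigA_distr_bigA
    (fun j o => (step_law j o)%:C%C * cis (step o * a j))) rmorph_prod.
  apply: eq_bigr => j _; rewrite sum_option_bool/= /sgb.
  rewrite mul0r mul1r mulN1r /cis cos0 sin0 cosN sinN.
  by apply/eqP; rewrite eq_complex/=; apply/andP; split; apply/eqP; field.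
by [].
Qed.

(** As the steps are present with probability at most 1/2, all factors are
    nonnegative and no absolute values arise. *)
Lemma walk_cos_mean_le a :
  \sum_t walk_law t * cos (walk a t) <= expR (- \sum_j q j * (1 - cos (a j))).
Proof.
rewrite walk_cos_mean -sumrN expR_sum; apply: ler_prod => j _.
have /andP[q0 q2] := q01 j; have := cos_geN1 (a j) => c0.
rewrite expR_ge1Dx andbT; nra.
Qed.

End random_signs.

(** * Waves along random signed sums *)

Section l2_norm.
Variable R : realType.

(** The part [b] is measured in l_2 and the part [c] in l_1, which is larger. *)
Lemma sqrt_sum_sq_le (K : finType) (u b c : K -> R) :
  (forall k, 0 <= c k) -> (forall k, `|u k| <= `|b k| + c k) ->
  Num.sqrt (\sum_k u k ^+ 2) <= Num.sqrt (\sum_k b k ^+ 2) + \sum_k c k.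
Proof.
move=> c0 ubc; set B := Num.sqrt (\sum_k b k ^+ 2).
have B0 : 0 <= B by exact: sqrtr_ge0.
have S0 : 0 <= \sum_k c k by apply: sumr_ge0.
have b2 : 0 <= \sum_k b k ^+ 2 by apply: sumr_ge0 => k _; exact: sqr_ge0.
have bB k : `|b k| <= B.
  rewrite -sqrtr_sqr ler_sqrt// (bigD1 k)//= lerDl.
  by apply: sumr_ge0 => j _; exact: sqr_ge0.
have cS k : c k <= \sum_j c j by rewrite (bigD1 k)//= lerDl sumr_ge0.
rewrite -[leRHS]ger0_norm ?addr_ge0// -sqrtr_sqr ler_sqrt ?sqr_ge0//.
apply: (@le_trans _ _ (\sum_k (b k ^+ 2 + c k * (2 * B + \sum_j c j)))).
  apply: ler_sum => k _; rewrite -(real_normK (num_real (u k))).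
  rewrite -(real_normK (num_real (b k))).
  have := ubc k; have := normr_ge0 (u k); have := normr_ge0 (b k).
  by have := bB k; have := cS k; have := c0 k; nra.
rewrite big_split/= -mulr_suml.
have -> : \sum_k b k ^+ 2 = B ^+ 2 by rewrite sqr_sqrtr.
by nra.
Qed.

(** Jensen's inequality for the square root, as an instance of
    Cauchy-Schwarz. *)
Lemma mean_sqrt_le (K : finType) (w X : K -> R) : (forall k, 0 <= w k) ->
  (forall k, 0 <= X k) -> \sum_k w k = 1 ->
  \sum_k w k * Num.sqrt (X k) <= Num.sqrt (\sum_k w k * X k).
Proof.
move=> w0 X0 w1.
have := sum_abs_mul_le (fun k => Num.sqrt (w k)) (fun k => Num.sqrt (w k * X k)).
have -> : \sum_k Num.sqrt (w k) ^+ 2 = 1.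
  by rewrite -w1; apply: eq_bigr => k _; rewrite sqr_sqrtr.
have -> : \sum_k Num.sqrt (w k * X k) ^+ 2 = \sum_k w k * X k.
  by apply: eq_bigr => k _; rewrite sqr_sqrtr// mulr_ge0.
rewrite sqrtr1 mul1r; apply: le_trans; rewrite le_eqVlt; apply/orP; left.
apply/eqP; apply: eq_bigr => k _.
by rewrite ger0_norm ?mulr_ge0// sqrtrM// mulrA -expr2 sqr_sqrtr.
Qed.

End l2_norm.

Section random_functional.
Variables (R : realType) (I J : finType) (q : J -> R) (a : I -> J -> R).
Hypothesis q01 : forall j, 0 <= q j <= 2^-1.

Definition phase : finType := (bool * {ffun J -> option bool})%type.

Definition phase_law (o : phase) : R := walk_law q o.2 / 2.

(** The cosine of a random linear functional minus a phase which is 0 or pi/2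
    with equal probability; the random phase makes the covariance a function of
    the difference of the two points. *)
Definition wave (o : phase) (x : I) : R :=
  if o.1 then cos (walk (a x) o.2) else sin (walk (a x) o.2).

Lemma phase_law_ge0 o : 0 <= phase_law o.
Proof. by rewrite divr_ge0// walk_law_ge0. Qed.

Lemma phase_sum (F : phase -> R) : \sum_o phase_law o * F o =
  \sum_t walk_law q t * ((F (true, t) + F (false, t)) / 2).
Proof.
rewrite (eq_bigr (fun o : phase => phase_law (o.1, o.2) * F (o.1, o.2)));
  last by case.
rewrite -(pair_bigA _ (fun b t => phase_law (b, t) * F (b, t)))/=.
rewrite big_bool -big_split/=; apply: eq_bigr => t _.
by rewrite /phase_law/=; field.
Qed.

Lemma phase_law_sum : \sum_o phase_law o = 1.
Proof.
under eq_bigr do rewrite -[phase_law _]mulr1.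
rewrite phase_sum (_ : (1 + 1) / 2 = 1); last by field.
by under eq_bigr do rewrite mulr1; rewrite walk_law_sum.
Qed.

Lemma wave_le1 o x : `|wave o x| <= 1.
Proof. by rewrite /wave; case: ifP => _; rewrite ?cos_max ?sin_max. Qed.

Lemma wave_covariance x y : \sum_o phase_law o * (wave o x * wave o y) =
  2^-1 * \sum_t walk_law q t * cos (walk (fun j => a x j - a y j) t).
Proof.
rewrite phase_sum mulr_sumr; apply: eq_bigr => t _.
by rewrite /wave/= -walkB cosB; field.
Qed.

Lemma wave_variance x : \sum_o phase_law o * wave o x ^+ 2 = 2^-1.
Proof.
under eq_bigr do rewrite expr2.
rewrite wave_covariance (eq_bigr (walk_law q)); first by rewrite walk_law_sum mulr1.
move=> t _; rewrite /walk big1 ?cos0 ?mulr1// => j _.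
by rewrite subrr mulr0.
Qed.

Lemma wave_displacement o x y :
  `|wave o x - wave o y| <= `|walk (fun j => a x j - a y j) o.2|.
Proof.
by rewrite /wave -walkB; case: ifP => _; [exact: cos_lipschitz|exact: sin_lipschitz].
Qed.

(** The predicate [small] is free; truncation at a level depending on [x], [y]
    and [m] will balance the two terms. Small terms enter by their variance,
    the others by their mean absolute value. *)
Lemma wave_displacement_mean (m : nat) (x y : I) (small : pred J) :
  \sum_(o : {ffun 'I_m -> phase}) (\prod_i phase_law (o i)) *
    Num.sqrt (\sum_i (wave (o i) x - wave (o i) y) ^+ 2) <=
  Num.sqrt (m%:R * \sum_(j | small j) q j * (a x j - a y j) ^+ 2) +
  m%:R * \sum_(j | ~~ small j) q j * `|a x j - a y j|.
Proof.
pose d j := a x j - a y j.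
pose d1 j := if small j then d j else 0.
pose d2 j := if small j then 0 else d j.
have dE t : walk d t = walk d1 t + walk d2 t.
  rewrite /walk -big_split/=; apply: eq_bigr => j _; rewrite -mulrDr.
  by rewrite /d1 /d2; case: ifP; rewrite ?addr0 ?add0r.
have prod0 (o : {ffun 'I_m -> phase}) : 0 <= \prod_i phase_law (o i).
  by apply: prodr_ge0 => i _; exact: phase_law_ge0.
have prod1 : \sum_(o : {ffun 'I_m -> phase}) \prod_i phase_law (o i) = 1.
  exact: (product_total (fun=> phase_law_sum)).
have marg (G : phase -> R) : \sum_(o : {ffun 'I_m -> phase})
    (\prod_i phase_law (o i)) * \sum_i G (o i) =
    m%:R * \sum_o phase_law o * G o.
  under eq_bigr do rewrite mulr_sumr.
  rewrite exchange_big/= (eq_bigr (fun=> \sum_o phase_law o * G o)).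
    by rewrite sumr_const card_ord mulr_natl.
  by move=> i _; exact: (product_marginal (fun=> phase_law_sum) i G).
apply: (@le_trans _ _ (\sum_(o : {ffun 'I_m -> phase})
    (\prod_i phase_law (o i)) *
    (Num.sqrt (\sum_i walk d1 (o i).2 ^+ 2) + \sum_i `|walk d2 (o i).2|))).
  apply: ler_sum => o _; rewrite ler_wpM2l//; apply: sqrt_sum_sq_le => // i.
  apply: le_trans (wave_displacement _ _ _) _.
  by rewrite -/d dE ler_normD.
under eq_bigr do rewrite mulrDr.
rewrite big_split/= lerD//.
  have X0 (o : {ffun 'I_m -> phase}) : 0 <= \sum_i walk d1 (o i).2 ^+ 2.
    by apply: sumr_ge0 => i _; exact: sqr_ge0.
  apply: (le_trans (mean_sqrt_le prod0 X0 prod1)).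
  rewrite (marg (fun o => walk d1 o.2 ^+ 2)) phase_sum/=.
  rewrite (eq_bigr (fun t => walk_law q t * walk d1 t ^+ 2)).
    rewrite walk_variance (big_mkcond small) (eq_bigr (fun j => if small j then
      q j * (a x j - a y j) ^+ 2 else 0))// => j _.
    by rewrite /d1; case: ifP => // _; rewrite expr0n mulr0.
  by move=> t _; congr (_ * _); field.
rewrite (marg (fun o => `|walk d2 o.2|)) phase_sum/= ler_wpM2l//.
rewrite (eq_bigr (fun t => walk_law q t * `|walk d2 t|)).
  apply: le_trans (walk_abs_mean_le q01 _) _.
  rewrite [leRHS]big_mkcond; apply: ler_sum => j _.
  by rewrite /d2; case: ifP => //= _; rewrite normr0 mulr0.
by move=> t _; congr (_ * _); field.
Qed.

End random_functional.

(** * Random partitions of finite subsets of finite-dimensional l_p *)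

Section finite_lp.
Variables (R : realType) (p : R).
Hypothesis p12 : 1 < p <= 2.

Let p0 : 0 < p. Proof. by have /andP[] := p12; lra. Qed.
Let p1 : 1 <= p. Proof. by have /andP[] := p12; lra. Qed.

Definition powsum (N : nat) (u : 'I_N -> R) : R := \sum_k `|u k| `^ p.

Lemma powsum_ge0 N (u : 'I_N -> R) : 0 <= powsum u.
Proof. by apply: sumr_ge0 => k _; exact: powR_ge0. Qed.

Lemma powsumZ N (c : R) (u : 'I_N -> R) :
  powsum (fun k => c * u k) = `|c| `^ p * powsum u.
Proof.
by rewrite /powsum mulr_sumr; apply: eq_bigr => k _; rewrite normrM powRM.
Qed.

(** Convexity of the p-th power. It serves as a triangle inequality at the one
    scale where it is needed: if two points are both within [D / 2] of a third
    one then they are within [D] of each other. *)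
Lemma powR_normD_le (s t : R) :
  `|s + t| `^ p <= 2 `^ (p - 1) * (`|s| `^ p + `|t| `^ p).
Proof.
have h : (`|s| + `|t|) `^ p <= 2 `^ (p - 1) * (`|s| `^ p + `|t| `^ p).
  have half01 : 0 <= (2^-1 : R) <= 1 by apply/andP; split; lra.
  have /andP[h0 h1] := half01.
  have := @convex_powR R p p1 (Itv01 h0 h1) `|s| `|t|.
  rewrite !inE/= !in_itv/= !andbT !normr_ge0 => /(_ isT isT).
  rewrite !convRE/= /unstable.onem => H.
  rewrite [X in X `^ p](_ : _ = 2^-1 * (`|s| + `|t|)) in H; last first.
    by rewrite mulrDr; congr (_ + _ * _); rewrite /unstable.onem/=; lra.
  rewrite (_ : 1 - 2^-1 = 2^-1 :> R) in H; last by lra.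
  rewrite -mulrDr powRM ?addr_ge0// in H.
  have : 2 `^ p * ((2^-1) `^ p * (`|s| + `|t|) `^ p) <=
     2 `^ p * (2^-1 * (`|s| `^ p + `|t| `^ p)) by rewrite ler_wpM2l// powR_ge0.
  rewrite mulrA -powRM// divff ?powR1 ?mul1r//; move/le_trans; apply.
  rewrite powRB ?powRr1//; last by apply/implyP.
  by rewrite mulrA.
apply: le_trans h; apply: ge0_ler_powR; rewrite ?nnegrE ?addr_ge0 ?(ltW p0)//.
exact: ler_normD.
Qed.

End finite_lp.

Section finite_partition.
Variables (R : realType) (p : R) (I : finType) (N : nat) (X : I -> 'I_N -> R).
Variables (D : R) (m : nat).
Hypothesis p12 : 1 < p <= 2.
Hypothesis D0 : 0 < D.

Let eta : R := 200^-1.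

Hypothesis m_large : 4 * #|I|%:R * expR (- (m%:R * eta ^+ 2 / 128)) <= 1.

Let p0 : 0 < p. Proof. by have /andP[] := p12; lra. Qed.

Let diff x y k := X x k - X y k.
Let sc : R := 2 / D.
Let sc0 : 0 < sc. Proof. by rewrite divr_gt0. Qed.

(** Finitely many differences occur, so a common number of levels is enough for
    all of them. *)
Let exists_levels : exists K : nat, forall x y k,
  sc * `|diff x y k| <= 2 ^+ K /\
  (sc * `|diff x y k| = 0 \/ 1 <= 2 ^+ K * (sc * `|diff x y k|)).
Proof.
have H (v : R) : 0 <= v -> exists K, v <= 2 ^+ K /\ (v = 0 \/ 1 <= 2 ^+ K * v).
  move=> v0.
  have big (u : R) : exists K, forall K', (K <= K')%N -> u <= 2 ^+ K'.
    exists (Num.bound `|u|) => K' KK'.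
    apply: (@le_trans _ _ (Num.bound `|u|)%:R).
      by apply: le_trans (ler_norm u) _; by apply/ltW/archi_boundP.
    rewrite -natrX ler_nat; apply: leq_trans KK' _.
    exact/ltnW/ltn_expl.
  have [K1 H1] := big v; have [K2 H2] := big v^-1.
  exists (maxn K1 K2); split; first by apply: H1; rewrite leq_maxl.
  case: (eqVneq v 0) => [|vn0]; [by left|right].
  have vp : 0 < v by rewrite lt_def vn0.
  by rewrite -ler_pdivrMr// div1r H2// leq_maxr.
have G (v : R) (K K' : nat) : (K <= K')%N -> 0 <= v -> v <= 2 ^+ K /\ (v = 0 \/ 1 <= 2 ^+ K * v) ->
    v <= 2 ^+ K' /\ (v = 0 \/ 1 <= 2 ^+ K' * v).
  move=> KK' v0 [h1 h2].
  have h3 : 2 ^+ K <= 2 ^+ K' :> R by rewrite ler_eXn2l// ltr1n.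
  split; first exact: le_trans h3.
  case: h2 => [|h2]; [by left|right].
  by apply: le_trans h2 _; rewrite ler_wpM2r.
pose val (t : I * I * 'I_N) := sc * `|diff t.1.1 t.1.2 t.2|.
have val0 t : 0 <= val t by rewrite mulr_ge0// ltW.
have [f Hf] := boolp.choice (fun t => H (val t) (val0 t)).
exists (\max_t f t) => x y k.
by apply: (G _ (f (x, y, k))); [exact: leq_bigmax|exact: (val0 (x, y, k))|exact: (Hf (x, y, k))].
Qed.

Let K := projT1 (boolp.cid exists_levels).
Let KP := projT2 (boolp.cid exists_levels).

Let J : finType := ('I_N * ('I_K.+1 + 'I_K.+1))%type.

Let level (l : 'I_K.+1 + 'I_K.+1) : R :=
  match l with inl l => (2^-1) ^+ l | inr l => 2 ^+ l end.

Let rate (l : 'I_K.+1 + 'I_K.+1) : R :=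
  match l with inl l => 2^-1 | inr l => 2^-1 * ((2 - p) * (2 `^ p)^-1 ^+ l) end.

Let q (j : J) : R := rate j.2.

Let a (x : I) (j : J) : R := level j.2 * (sc * X x j.1).

Let level0 l : 0 <= level l.
Proof. by case: l => l /=; rewrite exprn_ge0. Qed.

Let q01 j : 0 <= q j <= 2^-1.
Proof.
have /andP[p1 p2] := p12.
rewrite /q; case: j => k [l|l] /=; first by rewrite lexx andbT.
have w01 : 0 <= (2 `^ p)^-1 ^+ l <= 1.
  rewrite exprn_ge0 ?invr_ge0 ?powR_ge0//= exprn_ile1 ?invr_ge0 ?powR_ge0//.
  rewrite invf_le1 ?powR_gt0//.
  by have := pow2_ge (ltW p0); lra.
move: w01; move: (_ ^+ l) => W /andP[w0 w1].
by apply/andP; split; nra.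
Qed.

Let adiff x y j : a x j - a y j = level j.2 * (sc * diff x y j.1).
Proof. by rewrite /a -mulrBr -mulrBr. Qed.

Let adiff_norm x y j : `|a x j - a y j| = level j.2 * (sc * `|diff x y j.1|).
Proof.
by rewrite adiff normrM ger0_norm// normrM (@ger0_norm _ sc)// ltW.
Qed.

Let sum_levels (F : J -> R) :
  \sum_j F j = \sum_k (\sum_(l < K.+1) F (k, inl l) + \sum_(l < K.+1) F (k, inr l)).
Proof.
rewrite (eq_bigr (fun j => F (j.1, j.2))); last by case.
rewrite -(pair_bigA _ (fun k l => F (k, l)))/=; apply: eq_bigr => k _.
by rewrite big_sumType.
Qed.

Let energy_sum (v : 'I_N -> R) : (forall k, 0 <= v k) ->
  \sum_(j | level j.2 * v j.1 <= 1) q j * (level j.2 * v j.1) ^+ 2 =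
  \sum_k (2^-1 * low_energy K.+1 (v k) + 2^-1 * high_energy p K.+1 (v k)).
Proof.
move=> v0; rewrite big_mkcond sum_levels; apply: eq_bigr => k _.
rewrite /low_energy /high_energy !mulr_sumr; congr (_ + _); apply: eq_bigr => l _ /=.
  by case: ifP => _; rewrite ?mulr1 ?mulr0.
by case: ifP => _; rewrite /q/= ?mulr1 ?mulr0// !mulrA.
Qed.

Let overflow_sum (v : 'I_N -> R) : (forall k, 0 <= v k) ->
  \sum_(j | ~~ (level j.2 * v j.1 <= 1)) q j * (level j.2 * v j.1) =
  \sum_k (2^-1 * low_overflow K.+1 (v k) + 2^-1 * high_overflow p K.+1 (v k)).
Proof.
move=> v0; rewrite big_mkcond sum_levels; apply: eq_bigr => k _.
rewrite /low_overflow /high_overflow !mulr_sumr; congr (_ + _); apply: eq_bigr => l _ /=.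
  by rewrite -ltNge; case: ifP => _; rewrite ?mulr1 ?mulr0.
by rewrite -ltNge; case: ifP => _; rewrite /q/= ?mulr1 ?mulr0// !mulrA.
Qed.

Let near : rel I := fun x y => powsum p (diff x y) <= D `^ p.
Let far : rel I := fun x y => (D / 2) `^ p < powsum p (diff x y).

Let far_near x y y' : ~~ near y y' -> far x y || far x y'.
Proof.
rewrite -ltNge /far => h; apply: contraLR h; rewrite negb_or -!leNgt => /andP[h1 h2].
apply: (@le_trans _ _ (2 `^ (p - 1) * (powsum p (diff x y) + powsum p (diff x y')))).
  rewrite /powsum -big_split/= mulr_sumr; apply: ler_sum => k _.
  have -> : diff y y' k = - diff x y k + diff x y' k by rewrite /diff; ring.
  by rewrite -[X in X `^ p + _]normrN powR_normD_le.
apply: (@le_trans _ _ (2 `^ (p - 1) * (2 * (D / 2) `^ p))).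
  by rewrite ler_wpM2l ?powR_ge0//; lra.
rewrite powRB ?powRr1//; last by apply/implyP.
rewrite mulrA divfK// -powRM ?divr_ge0 ?(ltW D0)//.
by rewrite mulrC divfK.
Qed.

(** Distances are scaled so that [D / 2] becomes 1. The exponent in
    [walk_cos_mean_le] is then at least [1 / 4 * 1 / 8 = 1 / 32] for far points,
    and [expR (- 1 / 32) <= 32 / 33]. *)
Let cov_le x y : far x y ->
  \sum_o phase_law q o * (wave a o x * wave a o y) <= 2^-1 - 2 * eta.
Proof.
move=> fxy; rewrite wave_covariance.
have E : 32^-1 <= \sum_j q j * (1 - cos (a x j - a y j)).
  apply: (@le_trans _ _ (4^-1 * \sum_(j | level j.2 * (sc * `|diff x y j.1|) <= 1)
      q j * (level j.2 * (sc * `|diff x y j.1|)) ^+ 2)); last first.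
    rewrite mulr_sumr big_mkcond; apply: ler_sum => j _.
    have /andP[q0 _] := q01 j.
    case: ifP => [h|_]; last by rewrite mulr_ge0// subr_ge0 cos_le1.
    rewrite mulrCA ler_wpM2l// -adiff_norm real_normK ?num_real//.
    by rewrite mulrC one_sub_cos_ge// adiff_norm.
  have v0 k : 0 <= sc * `|diff x y k| by rewrite mulr_ge0// ltW.
  rewrite (energy_sum v0).
  apply: (@le_trans _ _ (4^-1 * \sum_k 8^-1 * Num.min 1 ((sc * `|diff x y k|) `^ p))).
    rewrite -mulr_sumr mulrA.
    suff : 1 <= \sum_k Num.min 1 ((sc * `|diff x y k|) `^ p) by lra.
    case: (pselect (exists k, 1 < (sc * `|diff x y k|) `^ p)) => [[k hk]|nk].
      rewrite (bigD1 k)//= (min_l (ltW hk)) lerDl sumr_ge0// => i _.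
      by rewrite le_min ler01 powR_ge0.
    have {}nk k : (sc * `|diff x y k|) `^ p <= 1.
      by rewrite leNgt; apply/negP => h; apply: nk; exists k.
    rewrite (eq_bigr (fun k => `|sc * diff x y k| `^ p)); last first.
      by move=> k _; rewrite min_r// normrM (gtr0_norm sc0).
    rewrite -/(powsum p (fun k => sc * diff x y k)) powsumZ (gtr0_norm sc0).
    have : sc `^ p * (D / 2) `^ p <= sc `^ p * powsum p (diff x y).
      by rewrite ler_wpM2l ?powR_ge0// ltW.
    rewrite -powRM ?divr_ge0 ?(ltW sc0) ?(ltW D0)// (_ : sc * (D / 2) = 1) ?powR1//.
    by rewrite /sc; field; rewrite gt_eqF.
  rewrite ler_wpM2l//; apply: ler_sum => k _.
  have [h1 h2] := KP x y k.
  exact: energy_ge.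
apply: (@le_trans _ _ (2^-1 * expR (- 32^-1))).
  rewrite ler_wpM2l//; apply: le_trans (walk_cos_mean_le q01 _) _.
  by rewrite ler_expR lerN2.
have : expR (- 32^-1) <= (1 + 32^-1)^-1 :> R.
  by rewrite expRN lef_pV2 ?posrE ?expR_gt0// ?expR_ge1Dx//; lra.
have -> : (1 + 32^-1)^-1 = 32 / 33 :> R by field.
by rewrite /eta; lra.
Qed.

(** Truncation at [T = m `^ p^-1 * t], where [t] is the scaled distance: the
    numbers [v k], the coordinates of the difference in units of [T], have
    p-th powers adding up to [1 / m]. *)
Let displacement x y :
  \sum_(o : {ffun 'I_m -> phase J}) (\prod_i phase_law q (o i)) *
    Num.sqrt (\sum_i (wave a (o i) x - wave a (o i) y) ^+ 2) <=
  5 / (p - 1) * (m%:R `^ p^-1 * (sc * powsum p (diff x y) `^ p^-1)).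
Proof.
have /andP[p1 p2] := p12.
have m0 : 0 < m%:R :> R.
  rewrite ltr0n lt0n; apply/negP => /eqP m0; have := m_large.
  rewrite m0 !mul0r oppr0 expR0 mulr1 leNgt => /negP; apply.
  have : 1 <= #|I|%:R :> R by rewrite ler1n; apply/card_gt0P; exists x.
  lra.
set t := sc * powsum p (diff x y) `^ p^-1; set T := m%:R `^ p^-1 * t.
have t0 : 0 <= t by rewrite mulr_ge0 ?powR_ge0// ltW.
have mp : 0 < m%:R `^ p^-1 :> R by rewrite powR_gt0.
have T0 : 0 <= T by rewrite mulr_ge0// ltW.
have r0 : 0 < p - 1 by lra.
case: (eqVneq (powsum p (diff x y)) 0) => [d0|dn0].
  have dk k : diff x y k = 0.
    apply/normr0_eq0/(@powR_eq0_eq0 _ _ p).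
    by apply: (psumr_eq0P _ d0) => // i _; exact: powR_ge0.
  rewrite big1 => [|o _]; first by rewrite mulr_ge0// divr_ge0// ltW.
  rewrite [X in Num.sqrt X]big1 ?sqrtr0 ?mulr0// => i _.
  have := wave_displacement a (o i) x y.
  rewrite /walk big1 ?normr0 ?normr_le0 => [/eqP->|j _]; first by rewrite expr0n.
  by rewrite adiff dk !mulr0.
have dp : 0 < powsum p (diff x y) by rewrite lt_def dn0 powsum_ge0.
have tp : 0 < t by rewrite mulr_gt0// powR_gt0.
have Tp : 0 < T by rewrite mulr_gt0.
pose v k := sc * `|diff x y k| / T.
have v0 k : 0 <= v k by rewrite divr_ge0// mulr_ge0// ltW.
have vsum : \sum_k v k `^ p = m%:R^-1.
  rewrite (eq_bigr (fun k => `|(sc / T) * diff x y k| `^ p)); last first.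
    by move=> k _; rewrite normrM gtr0_norm ?divr_gt0// /v mulrAC.
  rewrite -/(powsum p (fun k => sc / T * diff x y k)) powsumZ gtr0_norm ?divr_gt0//.
  have -> : sc / T = (m%:R * powsum p (diff x y)) `^ (- p^-1).
    rewrite powRN powRM ?powsum_ge0// /T /t; field.
    by rewrite !gt_eqF// powR_gt0.
  rewrite -powRrM mulNr mulVf ?gt_eqF// powRN powRr1 ?mulr_ge0 ?powsum_ge0//.
  by rewrite invfM mulfVK.
have dE j : `|a x j - a y j| = T * (level j.2 * v j.1).
  by rewrite adiff_norm /v; field; rewrite gt_eqF.
pose small (j : J) := level j.2 * v j.1 <= 1.
apply: (le_trans (wave_displacement_mean a q01 m x y small)).
have e1 : \sum_(j | small j) q j * (a x j - a y j) ^+ 2 <= 3 * T ^+ 2 / m%:R.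
  rewrite (eq_bigr (fun j => T ^+ 2 * (q j * (level j.2 * v j.1) ^+ 2))).
    rewrite -mulr_sumr (energy_sum v0) [leRHS]mulrAC [leRHS]mulrC.
    rewrite ler_wpM2l ?sqr_ge0// -vsum mulr_sumr; apply: ler_sum => k _.
    exact: energy_le.
  by move=> j _; rewrite -[in LHS]real_normK ?num_real// dE; ring.
have e2 : \sum_(j | ~~ small j) q j * `|a x j - a y j| <=
    3 / (p - 1) * T / m%:R.
  rewrite (eq_bigr (fun j => T * (q j * (level j.2 * v j.1)))).
    rewrite -mulr_sumr (overflow_sum v0) [leRHS]mulrAC [leRHS]mulrC.
    rewrite ler_wpM2l// -vsum mulr_sumr; apply: ler_sum => k _.
    exact: overflow_le.
  by move=> j _; rewrite dE; ring.
apply: (@le_trans _ _ (2 * T + 3 / (p - 1) * T)).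
  rewrite lerD//.
    have T20 : 0 <= 2 * T by lra.
    rewrite -[leRHS](ger0_norm T20) -sqrtr_sqr ler_sqrt ?sqr_ge0//.
    apply: (@le_trans _ _ (m%:R * (3 * T ^+ 2 / m%:R))).
      by rewrite ler_wpM2l.
    rewrite mulrC divfK ?gt_eqF//; have := sqr_ge0 T; nra.
  apply: (@le_trans _ _ (m%:R * (3 / (p - 1) * T / m%:R))).
    by rewrite ler_wpM2l.
  by rewrite mulrC divfK ?gt_eqF.
rewrite -mulrDl ler_wpM2r//.
have : 1 <= (p - 1)^-1 by rewrite -[leLHS]invr1 lef_pV2 ?posrE//; lra.
lra.
Qed.

Lemma lp_partition_explicit :
  exists P : {ffun I -> {set I}} -> R, [/\ forall g, 0 <= P g,
    \sum_g P g = 1,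
    forall g, 0 < P g -> forall x y, g x = g y ->
      powsum p (fun k => X x k - X y k) <= D `^ p &
    forall x y, \sum_(g : {ffun I -> {set I}} | g x != g y) P g <=
      20 * 801 * (m%:R `^ p^-1 / (p - 1)) / D *
        powsum p (fun k => X x k - X y k) `^ p^-1].
Proof.
have eta01 : 0 < eta <= 1 by rewrite /eta; apply/andP; split; lra.
have [P [P0 P1 Pn Ps]] := correlated_functionals_partition (phase_law_ge0 q01) (phase_law_sum q)
  (wave_le1 a) (wave_variance q a) cov_le eta01 far_near m_large.
exists P; split=> // x y; apply: le_trans (Ps x y) _.
apply: (@le_trans _ _ (2 * (1 + 4 / eta) *
  (5 / (p - 1) * (m%:R `^ p^-1 * (sc * powsum p (diff x y) `^ p^-1))))).
  rewrite ler_wpM2l ?displacement// /eta; lra.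
rewrite /eta /sc -/(diff x y) invrK le_eqVlt; apply/orP; left; apply/eqP.
have /andP[p1 _] := p12.
by field; rewrite !gt_eqF//; lra.
Qed.

End finite_partition.

(** The constant [C] is the price per unit of [m `^ p^-1 / (p - 1)], and [kappa]
    governs how large [m] has to be for the given number of points. *)
Definition lp_partitions (R : realType) (C kappa p : R) : Prop :=
  forall (I : finType) (N : nat) (X : I -> 'I_N -> R) (D : R) (m : nat),
    0 < D -> 4 * #|I|%:R * expR (- (kappa * m%:R)) <= 1 ->
  exists P : {ffun I -> {set I}} -> R, [/\ forall g, 0 <= P g,
    \sum_g P g = 1,
    forall g, 0 < P g -> forall x y, g x = g y ->
      powsum p (fun k => X x k - X y k) <= D `^ p &
    forall x y, \sum_(g : {ffun I -> {set I}} | g x != g y) P g <=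
      C * (m%:R `^ p^-1 / (p - 1)) / D *
        powsum p (fun k => X x k - X y k) `^ p^-1].

Lemma finite_lp_partition (R : realType) : exists C kappa : R,
  [/\ 0 < C, 0 < kappa & forall p, 1 < p <= 2 -> lp_partitions C kappa p].
Proof.
(* With eta = 1 / 200, C is the product of 2 * (1 + 4 / eta) = 2 * 801 from the
   density of the functions psi, 5 from the displacement, and 2 from measuring
   distances in units of D / 2. *)
exists (20 * 801), ((200^-1) ^+ 2 / 128); split.
- by apply: mulr_gt0; rewrite ltr0n.
- by apply: divr_gt0; rewrite ?exprn_gt0 ?invr_gt0 ?ltr0n.
- move=> p p12 I N X D m D0 m_large.
  apply: lp_partition_explicit p12 D0 _.
  rewrite -[m%:R * _ / _]mulrA [m%:R * _]mulrC; exact: m_large.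
Qed.

(** * From laws on labelings to separating random partitions *)

Local Open Scope classical_set_scope.
Local Open Scope ring_scope.

Section finite_law.
Variables (R : realType) (n : nat) (w : nat -> {nonneg R}).
Hypothesis w1 : \sum_(k < n) (w k)%:num = 1.

(** Point masses on the natural numbers. The proof that the weights add up to 1
    is an argument so that the probability structure can be inferred from the
    term. *)
Definition finite_law of \sum_(k < n) (w k)%:num = 1 : set nat -> \bar R :=
  msum (fun k => mscale (w k) \d_k) n.

HB.instance Definition _ := Measure.on (finite_law w1).

Let finite_law_setT : finite_law w1 setT = 1%E.
Proof.
rewrite /finite_law /msum/= /mscale/=.
rewrite (eq_bigr (fun k : 'I_n => (w k)%:num%:E)).
  by rewrite sumEFin w1.
by move=> k _; rewrite diracT mule1.
Qed.

HB.instance Definition _ :=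
  @Measure_isProbability.Build _ _ R (finite_law w1) finite_law_setT.

End finite_law.

Section labelings.
Variables (R : realType) (M : metricType R) (I L : finType) (r : M -> I).

(** The sample space is the set of indices of labelings. Diameters are bounded
    for every outcome, so the labelings of weight 0 and the indices beyond the
    range are replaced by a labeling of positive weight. *)
Lemma separable_of_labelings (sigma : R) :
  (forall Delta : R, 0 < Delta -> exists P : {ffun I -> L} -> R,
    [/\ forall g, 0 <= P g, \sum_g P g = 1,
     forall g, 0 < P g -> forall x y, g (r x) = g (r y) -> mdist x y <= Delta &
     forall x y, \sum_(g : {ffun I -> L} | g (r x) != g (r y)) P g <=
       sigma / Delta * mdist x y]) ->
  separable_with M sigma.
Proof.
move=> H Delta Delta0; have [P [P0 P1 Pb Ps]] := H _ Delta0.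
have [g0 Pg0] : exists g, 0 < P g.
  apply: contrapT => nP; have := P1; rewrite big1; first by move/esym/eqP; rewrite oner_eq0.
  move=> g _; apply/eqP; rewrite eq_le P0 andbT leNgt.
  by apply/negP => Pg; apply: nP; exists g.
pose lab (k : nat) : {ffun I -> L} := nth g0 (enum {: {ffun I -> L}}) k.
pose w k : {nonneg R} := NngNum (P0 (lab k)).
pose gg k := if 0 < P (lab k) then lab k else g0.
pose n := #|{: {ffun I -> L}}|.
have sumE (D : pred {ffun I -> L}) :
    \sum_(g | D g) P g = \sum_(k < n | D (lab k)) P (lab k).
  rewrite (reindex (fun k : 'I_n => enum_val k)).
    by apply: eq_big => k; rewrite (enum_val_nth g0).
  by apply: onW_bij; exact: enum_val_bij.
have w1 : \sum_(k < n) (w k)%:num = 1 by rewrite -P1 (sumE predT).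
pose Gamma (k : nat) (o : nat) : set M :=
  [set x | nat_of_ord (enum_rank (gg o (r x))) = k].
exists _, nat, [the probability _ _ of finite_law w1], Gamma; split.
- split=> //.
  + by move=> o i j _ _ [x []]; rewrite /Gamma/= => <- <-.
  + move=> o; apply/seteqP; split=> // x _.
    by exists (enum_rank (gg o (r x))).
- move=> o k x y; rewrite /Gamma/= => <- /ord_inj/enum_rank_inj gxy.
  by apply: (Pb (gg o)) => //; rewrite /gg; case: ifP.
- move=> x y.
  have sub : [set o | cluster_of Gamma o x <> cluster_of Gamma o y] `<=`
      [set o | gg o (r x) != gg o (r y)].
    move=> o /=; apply: contra_notN => /eqP gxy.
    by rewrite /cluster_of /Gamma/= gxy.
  apply: (@le_trans _ _ (finite_law w1 [set o | gg o (r x) != gg o (r y)])).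
    by apply: le_measure; rewrite ?inE.
  rewrite /finite_law /msum/= /mscale/=.
  rewrite (eq_bigr (fun k : 'I_n =>
    (P (lab k) * (lab k (r x) != lab k (r y))%:R)%:E)); last first.
    move=> k _; rewrite diracE EFinM.
    have -> : (nat_of_ord k \in [set o | gg o (r x) != gg o (r y)]) =
        (gg k (r x) != gg k (r y)) by apply/idP/idP; rewrite inE.
    have := P0 (lab k).
    rewrite le_eqVlt => /predU1P[<-|Pk]; first by rewrite !mul0e.
    by rewrite /gg Pk.
  rewrite sumEFin lee_fin; apply: le_trans (Ps x y).
  rewrite (sumE (fun g => g (r x) != g (r y))) [leRHS]big_mkcond.
  by apply: ler_sum => k _; case: ifP => _; rewrite ?mulr1 ?mulr0.
Qed.

End labelings.

(** * The upper bound *)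

Section ell_coordinates.
Variables (R : realType) (p : R) (p1 : 1 <= p).

Definition coord (u : ell p1) : nat -> R :=
  (u : LfunType (@counting nat R) (p1 : (1 <= p%:E)%E)).

Let p0 : 0 < p. Proof. exact: lt_le_trans ltr01 p1. Qed.

Lemma ell_mdist_series (u v : ell p1) : ((mdist u v)%:E =
  (\sum_(k <oo) (`|coord u k - coord v k| `^ p)%:E) `^ p^-1)%E.
Proof.
rewrite (finite_norm_fine ((u : LfunType _ _) - (v : LfunType _ _))).
by rewrite Lnorm_counting.
Qed.

Let partial (u v : ell p1) N : ((powsum p (fun k : 'I_N => coord u k - coord v k))%:E =
  \sum_(0 <= k < N) (`|coord u k - coord v k| `^ p)%:E)%E.
Proof. by rewrite sumEFin big_mkord. Qed.

Lemma ell_mdist_ge (u v : ell p1) N :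
  powsum p (fun k : 'I_N => coord u k - coord v k) `^ p^-1 <= mdist u v.
Proof.
rewrite -lee_fin ell_mdist_series -poweR_EFin; apply: gt0_ler_poweR.
- by rewrite invr_ge0 ltW.
- by rewrite in_itv/= leey andbT lee_fin powsum_ge0.
- by rewrite in_itv/= leey andbT nneseries_ge0// => k _ _; rewrite lee_fin powR_ge0.
rewrite partial; apply: nneseries_lim_ge => k _ _.
by rewrite lee_fin powR_ge0.
Qed.

(** Distances are limits of those of the truncated sequences, so finitely many
    coordinates detect that a distance is larger than [D]. *)
Lemma ell_mdist_gt (u v : ell p1) (D : R) : 0 <= D -> D < mdist u v ->
  exists N, D `^ p < powsum p (fun k : 'I_N => coord u k - coord v k).
Proof.
move=> D0 Duv; apply: contrapT => nN.
have h N : powsum p (fun k : 'I_N => coord u k - coord v k) <= D `^ p.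
  by rewrite leNgt; apply/negP => hN; apply: nN; exists N.
suff : mdist u v <= D by rewrite leNgt Duv.
rewrite -lee_fin ell_mdist_series.
have -> : D%:E = ((D `^ p)%:E `^ p^-1)%E.
  by rewrite poweR_EFin -powRrM divff ?gt_eqF// powRr1.
apply: gt0_ler_poweR.
- by rewrite invr_ge0 ltW.
- by rewrite in_itv/= leey andbT nneseries_ge0// => k _ _; rewrite lee_fin powR_ge0.
- by rewrite in_itv/= leey andbT lee_fin powR_ge0.
apply: lime_le.
  by apply: is_cvg_nneseries => k _ _; rewrite lee_fin powR_ge0.
by apply: nearW => N; rewrite -partial lee_fin.
Qed.

End ell_coordinates.

Section upper_bound.
Variables (R : realType) (p : R) (p1 : 1 < p) (p2 : p <= 2).

Let p0 : 0 < p. Proof. exact: lt_trans ltr01 p1. Qed.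

Notation lp := (ell (ltW p1)).

Variables C kappa : R.
Hypothesis C0 : 0 < C.
Hypothesis kappa0 : 0 < kappa.
Hypothesis partitions : lp_partitions C kappa p.

(** The points are indexed by ['I_n], with the zero sequence at the indices that
    are not used, and truncated to so many coordinates that the pairs at
    distance more than [D] remain so. Truncation does not increase distances,
    hence the separation bound survives. *)
Lemma separable_of_card_le (S : set lp) (n m : nat) :
  (S #<= `I_n)%card -> 4 * n%:R * expR (- (kappa * m%:R)) <= 1 ->
  separable_with (set_type S) (C * (m%:R `^ p^-1 / (p - 1))).
Proof.
move=> /pcard_leP[f] nm.
have fS (x : set_type S) : (f (set_val x) < n)%N.
  by have := @funS _ _ _ _ f (set_val x) (set_valP x).
pose r (x : set_type S) : 'I_n := Ordinal (fS x).
have rI : injective r.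
  move=> x y [] /(@inj _ _ _ f) xy; apply: val_inj; rewrite -!set_valE.
  by apply: xy; rewrite inE; exact: set_valP.
have HX i : exists u : nat -> R, forall x, r x = i -> u = coord (set_val x).
  case: (pselect (exists x, r x = i)) => [[x xi]|nx].
    by exists (coord (set_val x)) => y yi; rewrite (rI x y)// xi.
  by exists (fun=> 0) => x xi; case: nx; exists x.
have [X XP] := boolp.choice HX.
apply: (@separable_of_labelings R (set_type S) 'I_n {set 'I_n} r) => D D0.
have D0' := ltW D0.
have [N HN] : exists N, forall i j,
    (exists N', D `^ p < powsum p (fun k : 'I_N' => X i k - X j k)) ->
    D `^ p < powsum p (fun k : 'I_N => X i k - X j k).
  have mono N1 N2 i j : (N1 <= N2)%N ->
      powsum p (fun k : 'I_N1 => X i k - X j k) <=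
      powsum p (fun k : 'I_N2 => X i k - X j k).
    move=> N12; rewrite /powsum.
    rewrite -(big_mkord predT (fun k => `|X i k - X j k| `^ p)).
    rewrite -(big_mkord predT (fun k => `|X i k - X j k| `^ p)).
    rewrite [leRHS](big_cat_nat (n := N1))//= lerDl sumr_ge0//.
  have H (ij : 'I_n * 'I_n) : exists N,
      (exists N', D `^ p < powsum p (fun k : 'I_N' => X ij.1 k - X ij.2 k)) ->
      D `^ p < powsum p (fun k : 'I_N => X ij.1 k - X ij.2 k).
    case: (pselect (exists N', D `^ p < powsum p (fun k : 'I_N' => X ij.1 k - X ij.2 k))).
      by move=> [N' HN']; exists N'.
    by move=> nN; exists 0%N => /nN.
  have [F FP] := boolp.choice H.
  exists (\max_ij F ij) => i j /(FP (i, j))/lt_le_trans; apply.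
  by apply: mono; exact: (leq_bigmax (i, j)).
have nm' : 4 * #|'I_n|%:R * expR (- (kappa * m%:R)) <= 1 by rewrite card_ord.
have [P [P0 P1 Pn Ps]] := @partitions 'I_n N (fun i k => X i k) D m D0 nm'.
exists P; split => //.
- move=> g gP x y gxy; rewrite leNgt; apply/negP => /(ell_mdist_gt D0')[N' hN'].
  have /HN : exists N', D `^ p < powsum p (fun k : 'I_N' => X (r x) k - X (r y) k).
    by exists N'; rewrite (XP _ x erefl) (XP _ y erefl).
  by rewrite ltNge (Pn g gP).
- move=> x y; apply: le_trans (Ps (r x) (r y)) _.
  apply: ler_wpM2l.
    apply: divr_ge0 => //; apply: mulr_ge0; first exact: ltW.
    by apply: divr_ge0; [exact: powR_ge0|rewrite subr_ge0 ltW].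
  rewrite (XP _ x erefl) (XP _ y erefl).
  exact: (@ell_mdist_ge _ _ _ (set_val x) (set_val y) N).
Qed.

Lemma SEPn_le_one : (SEPn 1 lp <= 0)%E.
Proof.
apply: ge_ereal_sup => _ [S S1 <-]; apply/lee_addgt0Pr => e e0.
rewrite add0e; apply: ereal_inf_lbound; exists e => //; split=> //.
have S11 (x y : set_type S) : x = y.
  have /pcard_leP[f] := S1.
  have f0 (z : set_type S) : f (set_val z) = 0%N.
    have := @funS _ _ _ _ f (set_val z) (set_valP z).
    by rewrite /= ltnS leqn0 => /eqP.
  have /(@inj _ _ _ f) xy : f (set_val x) = f (set_val y) by rewrite !f0.
  by apply: val_inj; rewrite -!set_valE; apply: xy; rewrite inE; exact: set_valP.
apply: (@separable_of_labelings R (set_type S) unit unit (fun=> tt)) => D D0.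
exists (fun g => (g == [ffun => tt])%:R); split.
- by move=> g; rewrite ler0n.
- rewrite (bigD1 [ffun => tt])//= eqxx big1 ?addr0// => g.
  by move/negPf->.
- by move=> g _ x y _; rewrite (S11 x y) mdistxx ltW.
- move=> x y; rewrite big_pred0 ?mulr_ge0 ?mdist_ge0 ?invr_ge0 ?ltW//.
Qed.

(** With [m] between [3 / kappa * ln n] and [(3 / kappa + 2) * ln n] one has
    [4 * n * expR (- (kappa * m)) <= 4 * n / n ^ 3 <= 1], for [n >= 2]. *)
Lemma SEPn_le (n : nat) : (1 <= n)%N ->
  (SEPn n lp <= (C * (3 / kappa + 2) * (ln n%:R `^ p^-1 / (p - 1)))%:E)%E.
Proof.
rewrite leq_eqVlt => /predU1P[<-|n2].
  apply: le_trans SEPn_le_one _.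
  by rewrite lee_fin ln1 powR0 ?mul0r ?mulr0// invr_eq0 gt_eqF.
have nge2 : 2 <= n%:R :> R by rewrite ler_nat.
have n0 : 0 < n%:R :> R by lra.
have ln2n : 2^-1 <= ln n%:R :> R.
  by apply: le_trans (ln2_ge R) _; rewrite ler_ln ?posrE.
pose c : R := 3 / kappa.
have c0 : 0 <= c by rewrite divr_ge0// ltW.
have cl0 : 0 <= c * ln n%:R by rewrite mulr_ge0//; lra.
pose m := (Num.trunc (c * ln n%:R)).+1.
have mge : c * ln n%:R <= m%:R by have /andP[_ /ltW] := truncn_itv cl0.
have mle : m%:R <= (c + 2) * ln n%:R.
  have /andP[h _] := truncn_itv cl0.
  by rewrite /m -addn1 natrD mulrDl lerD//; lra.
have m_large : 4 * n%:R * expR (- (kappa * m%:R)) <= 1.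
  apply: (@le_trans _ _ (4 * n%:R * expR (- (3 * ln n%:R)))).
    rewrite ler_wpM2l ?mulr_ge0// ler_expR lerN2.
    rewrite (_ : 3 * ln n%:R = kappa * (c * ln n%:R)).
      by rewrite ler_wpM2l// ltW.
    by rewrite /c; field; rewrite gt_eqF.
  rewrite expRN ler_pdivrMr ?expR_gt0// mul1r expRM_natl lnK ?posrE//.
  by rewrite exprSr ler_wpM2r ?ler0n//; nra.
apply: ge_ereal_sup => _ [S Sn <-].
apply: (@le_trans _ _ (C * (m%:R `^ p^-1 / (p - 1)))%:E).
  apply: ereal_inf_lbound; exists (C * (m%:R `^ p^-1 / (p - 1))) => //.
  split; last exact: separable_of_card_le m_large.
  by rewrite mulr_gt0// divr_gt0 ?subr_gt0// powR_gt0// ltr0n.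
rewrite lee_fin -mulrA ler_wpM2l ?(ltW C0)//.
rewrite mulrA ler_wpM2r ?invr_ge0 ?subr_ge0 ?(ltW p1)//.
have ip0 : 0 <= p^-1 by rewrite invr_ge0 ltW.
apply: (@le_trans _ _ (((c + 2) * ln n%:R) `^ p^-1)).
  apply: ge0_ler_powR => //; rewrite nnegrE; first exact: ler0n.
  by apply: le_trans mle; exact: ler0n.
rewrite powRM; [|lra|lra].
rewrite ler_wpM2r ?powR_ge0// ler1_powR//; first by lra.
by rewrite invf_le1// ltW.
Qed.

End upper_bound.

(** * The lower bound *)

Section cube.
Local Open Scope nat_scope.
Variable d : nat.
Local Notation cube := {ffun 'I_d -> bool}.
Implicit Types x y : cube.

Definition ham x y : nat := \sum_i (x i != y i).

Definition flip (i : 'I_d) x : cube := [ffun k => (k == i) (+) x k].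

Lemma flipK i : involutive (flip i).
Proof. by move=> x; apply/ffunP => k; rewrite !ffunE addbA addbb. Qed.

Lemma ham_flip i x : ham x (flip i x) = 1%N.
Proof.
rewrite /ham (bigD1 i)//= ffunE eqxx big1; first by case: (x i).
by move=> k /negPf ki; rewrite ffunE ki eqxx.
Qed.

(** Each class of [c] gets a base point [rep]. Flipping exchanges the inner
    edges that go towards the base point ([down]) with those that go away from
    it ([up]); a point has as many inner edges of the first kind as it has
    inner flips among the coordinates where it differs from the base point, at
    most [d / 4]. *)
Lemma cut_edges (T : eqType) (c : cube -> T) :
  (forall x y, c x = c y -> 4 * ham x y <= d) ->
  #|{: cube}| * d <= 2 * \sum_x \sum_i (c x != c (flip i x)).
Proof.
move=> cd.
pose rep x := odflt x [pick y | c y == c x].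
have crep x : c (rep x) = c x.
  by rewrite /rep; case: pickP => [y /eqP|].
have eqrep x y : c x = c y -> rep x = rep y.
  rewrite /rep => cxy; rewrite (eq_pick (Q := fun z => c z == c y)).
    by case: pickP => //= /(_ y); rewrite eqxx.
  by move=> z /=; rewrite cxy.
pose inner i x := c x == c (flip i x).
have innerf i x : inner i (flip i x) = inner i x.
  by rewrite /inner flipK eq_sym.
pose down := \sum_x \sum_i (inner i x && (x i != rep x i)).
pose up := \sum_x \sum_i (inner i x && (x i == rep x i)).
have updown : up = down.
  rewrite /up /down exchange_big [RHS]exchange_big; apply: eq_bigr => i _.
  rewrite (reindex_inj (can_inj (flipK i))); apply: eq_bigr => x _ /=.
  rewrite innerf; case: (boolP (inner i x)) => //= /eqP/eqrep ->.
  by rewrite !ffunE eqxx addTb; case: (x i); case: (rep _ i).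
have all_edges : \sum_x \sum_i (c x != c (flip i x)) + (up + down) = #|{: cube}| * d.
  rewrite /up /down -!big_split/= -sum_nat_const; apply: eq_bigr => x _.
  rewrite -!big_split/= -[RHS]muln1 -[in RHS](card_ord d) -sum_nat_const.
  apply: eq_bigr => i _; rewrite /inner; case: (_ == _) => //=.
  by case: (_ == _).
have down_le : 4 * down <= #|{: cube}| * d.
  rewrite /down big_distrr/= -sum_nat_const; apply: leq_sum => x _.
  apply: leq_trans (cd x (rep x) _); last by rewrite crep.
  rewrite leq_mul2l/=; apply: leq_sum => i _.
  by case: (inner i x).
move: all_edges down_le; rewrite updown; lia.
Qed.

End cube.


Section cube_in_lp.
Variables (R : realType) (p : R) (p1 : 1 <= p) (d : nat).
Local Notation cube := {ffun 'I_d -> bool}.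

Let p0 : 0 < p. Proof. exact: lt_le_trans ltr01 p1. Qed.

Definition cube_fun (x : cube) (k : nat) : R :=
  if insub k is Some i then (x i)%:R else 0.

Let cube_fun_ord x (i : 'I_d) : cube_fun x i = (x i)%:R.
Proof. by rewrite /cube_fun valK. Qed.

Let cube_fun_ge x k : (d <= k)%N -> cube_fun x k = 0.
Proof. by move=> dk; rewrite /cube_fun insubF// ltnNge dk. Qed.

Let ham_sum x y : \sum_(0 <= k < d) `|cube_fun x k - cube_fun y k| `^ p = (ham x y)%:R.
Proof.
rewrite big_mkord /ham natr_sum; apply: eq_bigr => i _; rewrite !cube_fun_ord.
case: (x i); case: (y i); rewrite ?subrr ?subr0 ?sub0r ?normrN ?normr0 ?normr1;
  by rewrite ?powR1// powR0// gt_eqF.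
Qed.

Let ham_sum_le x y N :
  \sum_(0 <= k < N) `|cube_fun x k - cube_fun y k| `^ p <= (ham x y)%:R.
Proof.
rewrite -ham_sum; case: (leqP N d) => Nd.
  rewrite [leRHS](big_cat_nat (n := N))//= lerDl.
  by apply: sumr_ge0 => k _; exact: powR_ge0.
rewrite [leLHS](big_cat_nat (n := d))//= ?(ltnW Nd)//.
rewrite [X in _ + X]big_nat_cond [X in _ + X]big1 ?addr0// => k.
rewrite andbT => /andP[dk _].
by rewrite !cube_fun_ge// subrr normr0 powR0// gt_eqF.
Qed.

Let cube_fun_Lfun x : cube_fun x \in Lfun (@counting nat R) p%:E.
Proof.
rewrite inE; apply/andP; split; rewrite inE/=.
  by [].
rewrite /finite_norm Lnorm_counting//.
rewrite (@le_lt_trans _ _ (((ham x [ffun=> false])%:R `^ p^-1)%:E))%E ?ltry//.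
rewrite -poweR_EFin; apply: gt0_ler_poweR.
- by rewrite invr_ge0 ltW.
- by rewrite in_itv/= leey andbT nneseries_ge0// => k _ _; rewrite poweR_ge0.
- by rewrite in_itv/= leey andbT lee_fin.
apply: lime_le; first by apply: is_cvg_nneseries => k _ _; rewrite poweR_ge0.
apply: nearW => N; rewrite sumEFin lee_fin.
apply: le_trans (ham_sum_le x [ffun=> false] N).
apply: ler_sum => k _; rewrite [X in _ - X](_ : _ = 0) ?subr0//.
by rewrite /cube_fun; case: insub => // i; rewrite ffunE.
Qed.

Definition cube_point (x : cube) : ell p1 :=
  Lfun_Sub (p1 : (1 <= p%:E)%E) (cube_fun_Lfun x).

Let coord_cube x : coord (cube_point x) = cube_fun x.
Proof. by []. Qed.

(** The p-th power of the distance of two vertices is their Hamming distance. *)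
Lemma ham_le_mdist x y (D : R) :
  mdist (cube_point x) (cube_point y) <= D -> (ham x y)%:R <= D `^ p.
Proof.
move=> /(le_trans (ell_mdist_ge (cube_point x) (cube_point y) d)).
rewrite /powsum !coord_cube -(big_mkord predT
  (fun k => `|cube_fun x k - cube_fun y k| `^ p)) ham_sum => h.
have -> : (ham x y)%:R = ((ham x y)%:R `^ p^-1) `^ p :> R.
  by rewrite -powRrM mulVf ?gt_eqF// powRr1.
have D0 : 0 <= D by apply: le_trans h; exact: powR_ge0.
by apply: ge0_ler_powR => //; rewrite ?nnegrE ?powR_ge0 ?(ltW p0).
Qed.

Lemma mdist_cube_flip i x : mdist (cube_point x) (cube_point (flip i x)) <= 1.
Proof.
rewrite leNgt; apply/negP => /(ell_mdist_gt ler01)[N].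
rewrite powR1 /powsum !coord_cube -(big_mkord predT
  (fun k => `|cube_fun x k - cube_fun (flip i x) k| `^ p)).
by rewrite ltNge (le_trans (ham_sum_le _ _ _))// ham_flip.
Qed.

End cube_in_lp.

Section lower_bound.
Variables (R : realType) (M : metricType R).

Lemma closed_singleton (x : M) : closed [set x].
Proof. exact/accessible_closed_set1/hausdorff_accessible/metric_hausdorff. Qed.

Section partition_events.
Context dsp (Omega : measurableType dsp) (Gamma : nat -> Omega -> set M).
Hypothesis GammaP : random_partition Gamma.

(** The clusters are disjoint and cover the space, so a cluster is determined by
    any of its points. *)
Lemma cluster_eqE w x y : cluster_of Gamma w x = cluster_of Gamma w y <->
  exists k, Gamma k w x /\ Gamma k w y.
Proof.
have [tr cov _] := GammaP.
have uniq k k' z : Gamma k w z -> Gamma k' w z -> k = k'.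
  by move=> kz k'z; apply: (tr w) => //; exists z.
split=> [E|[k [kx ky]]].
  have : [set: M] x by [].
  rewrite -(cov w) => -[k _ kx].
  have : cluster_of Gamma w x x by exists k.
  rewrite E => -[k' k'y k'x]; exists k'; split=> //.
have cE z : Gamma k w z -> cluster_of Gamma w z = Gamma k w.
  move=> kz; apply/seteqP; split=> [t [k' /= k'z]|t kt]; last by exists k.
  by rewrite (uniq _ _ _ k'z kz).
by rewrite !cE.
Qed.

Lemma measurable_separated x y :
  measurable [set w | cluster_of Gamma w x <> cluster_of Gamma w y].
Proof.
have [_ _ mG] := GammaP.
have mx k z : measurable [set w | Gamma k w z].
  rewrite (_ : mkset _ = [set w | [set z] `&` Gamma k w !=set0]).
    exact/mG/closed_singleton.
  by apply/seteqP; split=> w /=; [exists z|case=> t [-> ]].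
rewrite (_ : mkset _ = ~` (\bigcup_k ([set w | Gamma k w x] `&` [set w | Gamma k w y]))).
  by apply: measurableC; apply: bigcup_measurable => k _; exact: measurableI.
apply/seteqP; split=> w /=; rewrite cluster_eqE.
  by move=> nk [k _ /= kk]; apply: nk; exists k.
by move=> nk [k kk]; apply: nk; exists k.
Qed.

End partition_events.

(** Integrate over the sample space the number of pairs of a vertex and a flip
    that are cut: it is everywhere at least half of all pairs, while each single
    pair is cut with probability at most [sigma / Delta]. *)
Lemma cube_separation (d : nat) (pt : {ffun 'I_d -> bool} -> M) (Delta sigma : R) :
  (0 < d)%N -> 0 < Delta -> 0 < sigma ->
  (forall x i, mdist (pt x) (pt (flip i x)) <= 1) ->
  (forall x y, mdist (pt x) (pt y) <= Delta -> (4 * ham x y <= d)%N) ->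
  separable_with M sigma -> Delta / 2 <= sigma.
Proof.
move=> d0 Delta0 sigma0 edge bd /(_ Delta Delta0) [dsp [T [P [Gamma]]]] [GP Gb Gs].
pose A x i : set T := [set w | cluster_of Gamma w (pt x) <> cluster_of Gamma w (pt (flip i x))].
have mA x i : measurable (A x i) by exact: measurable_separated.
pose V := #|{: {ffun 'I_d -> bool}}|.
have V0 : (0 < V)%N by rewrite /V card_ffun card_bool expn_gt0.
have cut w : (V * d)%:R / 2 <= \sum_x \sum_i \1_(A x i) w :> R.
  have [_ cov _] := GP.
  have ck x : exists k, Gamma k w (pt x).
    have : [set: M] (pt x) by [].
    by rewrite -(cov w) => -[k _ kx]; exists k.
  have [c cP] := boolp.choice ck.
  have cE x y : (c x == c y) = `[< cluster_of Gamma w (pt x) = cluster_of Gamma w (pt y) >].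
    apply/eqP/asboolP => [cxy|].
      by apply/(cluster_eqE GP); exists (c x); split => //; rewrite cxy.
    move=> /(cluster_eqE GP)[k [kx ky]].
    have [tr _ _] := GP.
    have -> : c x = k by apply: (tr w) => //; exists (pt x).
    by apply: (tr w) => //; exists (pt y).
  have : (V * d <= 2 * \sum_x \sum_i (c x != c (flip i x)))%N.
    apply: cut_edges => x y cxy; apply: bd; apply: (Gb w (c x)) => //.
    by rewrite cxy.
  rewrite -(ler_nat R) natrM [in X in _ <= X -> _]natrM => h.
  rewrite ler_pdivrMr// [leRHS]mulrC; apply: le_trans h _.
  rewrite ler_wpM2l// natr_sum; apply: ler_sum => x _.
  rewrite natr_sum; apply: ler_sum => i _.
  rewrite indicE ler_nat; case: (boolP (c x == c _)) => //= cx.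
  rewrite (_ : (w \in A x i) = true)//; apply/mem_set => /=.
  by apply/asboolP; rewrite asbool_neg -cE.
have key : (((V * d)%:R / 2)%:E <= \sum_x \sum_i P (A x i))%E.
  have -> : (\sum_x \sum_i P (A x i) = \int[P]_w (\sum_x \sum_i \1_(A x i) w)%:E)%E.
    under [RHS]eq_integral => w _.
      rewrite -sumEFin.
      under eq_bigr do rewrite -sumEFin.
    over.
    rewrite ge0_integral_sum//; last 2 first.
    - move=> x; apply: emeasurable_sum => i.
      by apply/measurable_EFinP; exact: measurable_indic.
    - by move=> x w _; apply: sume_ge0 => i _; rewrite lee_fin.
    apply: eq_bigr => x _; rewrite ge0_integral_sum//; last first.
      by move=> i; apply/measurable_EFinP; exact: measurable_indic.
    by apply: eq_bigr => i _; rewrite integral_indic// setIT.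
  rewrite -[leLHS]mule1 -(@probability_setT _ _ _ P) -integral_cst//.
  apply: ge0_le_integral => //.
  - by move=> w _; rewrite lee_fin divr_ge0.
  - apply/measurable_EFinP; apply: measurable_sum => x.
    by apply: measurable_sum => i; exact: measurable_indic.
  - by move=> w _; rewrite lee_fin.
have up : (\sum_x \sum_i P (A x i) <= ((V * d)%:R * (sigma / Delta))%:E)%E.
  apply: (@le_trans _ _ (\sum_(x : {ffun 'I_d -> bool}) \sum_(i < d) (sigma / Delta)%:E)%E).
    apply: lee_sum => x _; apply: lee_sum => i _; apply: le_trans (Gs _ _) _.
    by rewrite lee_fin ler_piMr// divr_ge0// ltW.
  under eq_bigr do rewrite sumEFin sumr_const card_ord -[_ *+ d]mulr_natl.
  rewrite sumEFin lee_fin sumr_const -[leLHS]mulr_natl natrM -mulrA.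
  exact: lexx.
have := le_trans key up; rewrite lee_fin ler_pM2l; last first.
  by rewrite ltr0n muln_gt0 V0 d0.
by rewrite ler_pdivlMr// mulrC.
Qed.

End lower_bound.

Section SEPn_lower_bound.
Variables (R : realType) (p : R) (p1 : 1 < p) (p2 : p <= 2).

Let p0 : 0 < p. Proof. exact: lt_trans ltr01 p1. Qed.

Lemma SEPn_ge (n : nat) : (1 <= n)%N ->
  ((16^-1 * ln n%:R `^ p^-1)%:E <= SEPn n (ell (ltW p1)))%E.
Proof.
move=> n1; pose d := trunc_log 2 n.
have /andP[dn nd] : (2 ^ d <= n < 2 ^ d.+1)%N by exact: trunc_log_bounds.
pose cube := {ffun 'I_d -> bool}.
pose e : cube -> ell (ltW p1) := @cube_point R p (ltW p1) d.
pose g (k : nat) := e (nth [ffun=> false] (enum {: cube}) k).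
pose S := g @` `I_n.
apply: (@le_trans _ _ (SEP (set_type S))); last first.
  by apply: ereal_sup_ubound; exists S => //; exact: card_image_le.
have eS x : S (e x).
  exists (enum_rank x); last by rewrite /g nth_enum_rank.
  rewrite /=; apply: leq_trans dn; apply: leq_trans (ltn_ord _) _.
  by rewrite card_ffun card_bool card_ord.
pose pt x : set_type S := SigSub (mem_set (eS x)).
apply: le_ereal_inf_tmp => _ [sigma [sigma0 sep] <-]; rewrite lee_fin.
have ip0 : 0 < p^-1 by rewrite invr_gt0.
have [d0|d0] := posnP d.
  have -> : n = 1%N by apply/eqP; rewrite eqn_leq n1 andbT -ltnS; rewrite d0 in nd.
  by rewrite ln1 powR0 ?mulr0 ?gt_eqF// ltW.
(* The largest diameter for which clusters have Hamming diameter at most d / 4. *)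
pose Delta : R := (d%:R / 4) `^ p^-1.
have dr : 1 <= d%:R :> R by rewrite ler1n.
have Delta0 : 0 < Delta by rewrite powR_gt0// divr_gt0//; lra.
have : Delta / 2 <= sigma.
  apply: (@cube_separation R (set_type S) d pt) => //.
  - by move=> x i; exact: mdist_cube_flip.
  - move=> x y /ham_le_mdist.
    rewrite /Delta -powRrM mulVf ?gt_eqF// powRr1 ?divr_ge0//.
    by rewrite ler_pdivlMr// -natrM ler_nat mulnC.
apply: le_trans.
(* Here n < 2 ^ (d + 1) and d + 1 <= 2 * d. *)
have lnn : ln n%:R <= 8 * (d%:R / 4) :> R.
  apply: (@le_trans _ _ (ln (2 ^+ d.+1))).
    rewrite ler_ln ?posrE ?ltr0n ?exprn_gt0//.
    by rewrite -natrX ler_nat ltnW.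
  rewrite lnXn// -[ln 2 *+ _]mulr_natr -natr1; have := ln2_le R; nra.
have ln0 : 0 <= ln n%:R :> R by rewrite ln_ge0// ler1n.
have h : ln n%:R `^ p^-1 <= 8 * Delta.
  apply: (@le_trans _ _ ((8 * (d%:R / 4)) `^ p^-1)).
    by apply: ge0_ler_powR; rewrite ?nnegrE ?(ltW ip0)// mulr_ge0// divr_ge0.
  rewrite powRM ?divr_ge0// ler_wpM2r ?powR_ge0// ler1_powR ?invf_le1 ?(ltW p1)//.
  by rewrite ler1n.
lra.
Qed.

End SEPn_lower_bound.

Theorem theorem81 (R : realType) :
  exists c C : R, [/\ 0 < c, 0 < C &
    forall (p : R) (p1 : 1 < p) (p2 : p <= 2) (n : nat) (n1 : (1 <= n)%N),
      ((c * ln n%:R `^ p^-1)%:E <= SEPn n (ell (ltW p1)))%E /\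
      (SEPn n (ell (ltW p1)) <= (C * (ln n%:R `^ p^-1 / (p - 1)))%:E)%E].
Proof.
have [C [kappa [C0 kappa0 partitions]]] := finite_lp_partition R.
exists 16^-1, (C * (3 / kappa + 2)); split.
- by rewrite invr_gt0.
- by rewrite mulr_gt0// addr_gt0// divr_gt0.
- move=> p p1 p2 n n1; split; first exact: SEPn_ge.
  by apply: SEPn_le => //; apply: partitions; rewrite p1.
Qed.
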